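(* Suppose the dual structure is simple, in the sense that the dual maximization problem $\max_{y\in\mathcal Y}\Phi(x,y)-g(y)-\rho\,\omega_{\mathcal Y}(y)$ can be solved exactly for every $x\in\mathcal X$ (so that the subproblems of the primal-dual smoothing framework, Algorithm 1 in the context, are solved by the exact accelerated proximal gradient (APG) method applied to the primal problem, as described in the context). For any $\varepsilon>0$, if $\lambda=0.9\gamma^{-1}$ and $\eta=\varepsilon^2\lambda(1-\gamma\lambda)/(32\beta_{\mathcal X}^2)$, then Algorithm 1 finds an $\varepsilon$-near-stationary point of $\min_{x\in\mathbb X}q(x)$ with primal gradient complexity $$O\left(\big(\sqrt{\gamma L_{xx}}+L_{xy}\gamma\varepsilon^{-1}\big)\,\varepsilon^{-2}\ln(\varepsilon^{-1})\right).$$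
   Context: Problem. $\mathbb X,\mathbb Y$ are finite-dimensional real normed spaces (norms $\|\cdot\|$, dual norms $\|\cdot\|_*$). $r:\mathbb X\to\mathbb R\cup\{+\infty\}$ is closed and convex with $\mathcal X:=\operatorname{dom} r$ nonempty, closed, convex. $\mathcal Y\subseteq\mathbb Y$ is nonempty, convex and compact; $g:\mathcal Y\to\mathbb R$ is convex and continuous. $\mathcal X'\supseteq\mathcal X$, $\mathcal Y'\supseteq\mathcal Y$ are open; $\Phi:\mathcal X'\times\mathcal Y'\to\mathbb R$ is jointly continuous and $\Phi(x,\cdot)$ is concave on $\mathcal Y$ for each $x\in\mathcal X$. Let $f(x):=\max_{y\in\mathcal Y}\Phi(x,y)-g(y)$, $q:=f+r$ (equal to $+\infty$ off $\mathcal X$), $q^*:=\min_{x\in\mathbb X}q(x)$, assumed $>-\infty$. Assumptions: (1) for $y\in\mathcal Y$, $\Phi(\cdot,y)$ is differentiable on $\mathcal X'$ and for $x,x'\in\mathcal X$, $y,y'\in\mathcal Y$: $\|\nabla_x\Phi(x,y)-\nabla_x\Phi(x',y)\|_*\le L_{xx}\|x-x'\|$, $\|\nabla_x\Phi(x,y)-\nabla_x\Phi(x,y')\|_*\le L_{xy}\|y-y'\|$. (2) For some $\gamma\in(0,L_{xx}]$, for all $y\in\mathcal Y$, $x,x'\in\mathcal X$: $\Phi(x',y)-\Phi(x,y)-\langle\nabla_x\Phi(x,y),x'-x\rangle\ge-(\gamma/2)\|x'-x\|^2$. (No differentiability of $\Phi(x,\cdot)$ is assumed here.) Distance generating functions (DGF).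 For a nonempty closed convex set $\mathcal U$ in a finite-dimensional normed space $\mathbb U$, $\omega_{\mathcal U}:\mathbb U\to\mathbb R\cup\{+\infty\}$ is a DGF on $\mathcal U$ if it is continuous and 1-strongly convex on $\mathcal U$ and essentially smooth (continuously differentiable on $\operatorname{int}\operatorname{dom}\omega_{\mathcal U}$, with $\|\nabla\omega_{\mathcal U}(u_k)\|_*\to+\infty$ whenever $u_k\in\operatorname{int}\operatorname{dom}\omega_{\mathcal U}$ converges to a boundary point of $\operatorname{dom}\omega_{\mathcal U}$). $\mathcal U^o:=\mathcal U\cap\operatorname{int}\operatorname{dom}\omega_{\mathcal U}$, $D_{\omega_{\mathcal U}}(u',u):=\omega_{\mathcal U}(u')-\omega_{\mathcal U}(u)-\langle\nabla\omega_{\mathcal U}(u),u'-u\rangle$. $\omega_{\mathcal X}$ is a DGF on $\mathcal X$ that is twice continuously differentiable on $\operatorname{int}\operatorname{dom}\omega_{\mathcal X}$, with $\mathcal X\subseteq\operatorname{int}\operatorname{dom}\omega_{\mathcal X}$ and $\nabla\omega_{\mathcal X}$ $\beta_{\mathcal X}$-Lipschitz on $\mathcal X$, $\beta_{\mathcal X}\in[1,\infty)$. $\omega_{\mathcal Y}$ is a DGF on $\mathcal Y$, and $R_{\mathcal Y}(\omega_{\mathcal Y}):=\sup_{y\in\mathcal Y}|\omega_{\mathcal Y}(y)|<\infty$ (positive). The problems $\min_{x\in\mathcal X}r(x)+\langle\xi,x\rangle+\alpha^{-1}\omega_{\mathcal X}(x)$, $\alpha>0$, have unique, easily computable solutions in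 $\mathcal X$. Smoothing. For $\rho>0$: $f_\rho(x):=\max_{y\in\mathcal Y}\Phi(x,y)-g(y)-\rho\,\omega_{\mathcal Y}(y)$ with unique maximizer $y^*_\rho(x)$ for $x\in\mathcal X$, and $q_\rho:=f_\rho+r$. For $0<\lambda<\gamma^{-1}$, $x\in\mathcal X$: $\operatorname{prox}(q,x,\lambda):=\arg\min_{x'\in\mathbb X}q(x')+\lambda^{-1}D_{\omega_{\mathcal X}}(x',x)$, $Q_\rho^\lambda(x';x):=q_\rho(x')+\lambda^{-1}D_{\omega_{\mathcal X}}(x',x)$, $q_\rho^\lambda(x):=\min_{x'\in\mathbb X}Q_\rho^\lambda(x';x)$. A point $x\in\mathcal X$ is $\varepsilon$-near-stationary if for some $0<\lambda<\gamma^{-1}$, $\|\lambda^{-1}(x-\operatorname{prox}(q,x,\lambda))\|\le\varepsilon/\beta_{\mathcal X}$. Algorithm 1. Input: $\eta>0$, $\lambda\in(0,\gamma^{-1})$, $\rho:=2\eta/R_{\mathcal Y}(\omega_{\mathcal Y})$, $x_1\in\mathcal X$. For $k=1,2,\ldots$: find $x_{k+1}\in\mathcal X$ with $Q_\rho^\lambda(x_{k+1};x_k)\le q_\rho^\lambda(x_k)+\eta$; terminate at the first $k$ for which $\|x_{k+1}-x_k\|\le\sqrt{2\eta/(\lambda^{-1}-\gamma)}$; output $x_K$ with $K$ this $k$. Subproblem solver. Up to a constant, $Q_\rho^\lambda(x;x_k)=h(x)+r(x)+\mu\omega_{\mathcal X}(x)$ with $\mu=\lambda^{-1}-\gamma$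 and $h(x)=f_\rho(x)+\gamma\omega_{\mathcal X}(x)-\lambda^{-1}\langle\nabla\omega_{\mathcal X}(x_k),x\rangle$, whose gradient used on $\mathcal X$ is $\nabla h(x)=\nabla_x\Phi(x,y^*_\rho(x))+\gamma\nabla\omega_{\mathcal X}(x)-\lambda^{-1}\nabla\omega_{\mathcal X}(x_k)$. Apply the following exact APG method with $\mathcal U=\mathcal X$, $\zeta=r$, $\bar L=L_{xx}+\gamma\beta_{\mathcal X}+L_{xy}^2/\rho$ until an $\eta$-optimal point $x_{k+1}$ is found: $\theta=\mu/\bar L$, $\alpha_0=1$, $\alpha_t=(1+\sqrt\theta)^{t-1}\sqrt\theta$ ($t\ge1$), $A_t=\sum_{i\le t}\alpha_i$, $\tau_t=\alpha_t/A_t$; $u_0\in\mathcal U^o$, $s_0=\nabla h(u_0)$, $z_0=\arg\min_{u\in\mathcal U}\langle s_0,u\rangle+\zeta(u)+\mu\omega_{\mathcal U}(u)+\bar LD_{\omega_{\mathcal U}}(u,u_0)$; for $t\ge0$: $\bar u_{t+1}=\arg\min_{u\in\mathcal U}\langle s_t,u\rangle+A_t(\zeta(u)+\mu\omega_{\mathcal U}(u))+\bar LD_{\omega_{\mathcal U}}(u,u_0)$; $u_{t+1}=(1-\tau_{t+1})z_t+\tau_{t+1}\bar u_{t+1}$; $s_{t+1}=s_t+\alpha_{t+1}\nabla h(u_{t+1})$; $w_{t+1}=\arg\min_{u\in\mathcal U}\alpha_{t+1}(\langle\nabla h(u_{t+1}),u\rangle+\zeta(u)+\mu\omega_{\mathcal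 U}(u))+(A_t\mu+\bar L)D_{\omega_{\mathcal U}}(u,\bar u_{t+1})$; $z_{t+1}=(1-\tau_{t+1})z_t+\tau_{t+1}w_{t+1}$. Complexity. The primal gradient complexity is the total number of evaluations of $\nabla_x\Phi$. In $O(\cdot)$ the displayed dependence is on $L_{xx},L_{xy},\gamma$ and (small) $\varepsilon$; the factors $q(x_1)-q^*$, $\beta_{\mathcal X}$, $R_{\mathcal Y}(\omega_{\mathcal Y})$, Bregman distances from the solver's starting points, and problem constants inside the logarithm are suppressed. *)

(* Defs.v *)
From HB Require Import structures.
From mathcomp Require Import all_boot all_order all_algebra.
From mathcomp Require Import all_classical all_reals all_analysis.

Set Implicit Arguments.
Unset Strict Implicit.
Unset Printing Implicit Defensive.

Import Order.TTheory GRing.Theory Num.Theory.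
Import numFieldNormedType.Exports.

Local Open Scope classical_set_scope.
Local Open Scope ring_scope.

Definition finite_dim (R : realType) (V : normedModType R) : Prop :=
  exists (n : nat) (b : 'I_n -> V),
    forall v : V, exists c : 'I_n -> R, v = \sum_(i < n) c i *: b i.

(* In finite dimension every linear functional is bounded, so the real-valued
   supremum below is the true one. *)
Definition dual_norm (R : realType) (V : normedModType R) (xi : V -> R) : R :=
  sup [set xi v | v in [set v : V | `|v| <= 1]].

Definition argmin (R : realType) (T : Type) (A : set T) (F : T -> \bar R) : set T :=
  [set a | A a /\ forall b, A b -> (F a <= F b)%E].

Definition argmax (R : realType) (T : Type) (A : set T) (F : T -> R) : set T :=
  [set a | A a /\ forall b, A b -> F b <= F a].

(* Functions with values in R \cup {+oo} are maps to \bar R avoiding -oo. *)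
Definition proper_valued (R : realType) (T : Type) (F : T -> \bar R) : Prop :=
  forall x, F x != -oo%E.

Definition edom (R : realType) (T : Type) (F : T -> \bar R) : set T :=
  [set x | (F x < +oo)%E].

Definition convex_efun (R : realType) (V : lmodType R) (F : V -> \bar R) : Prop :=
  forall (u v : V) (t : R), 0 <= t <= 1 ->
    (F (t *: u + (1 - t) *: v)%R <= t%:E * F u + (1 - t)%:E * F v)%E.

Definition strongly_convex_on (R : realType) (V : normedModType R) (A : set V)
    (F : V -> \bar R) : Prop :=
  forall (u v : V) (t : R), A u -> A v -> 0 <= t <= 1 ->
    (F (t *: u + (1 - t) *: v)%R <=
       t%:E * F u + (1 - t)%:E * F v - (t * (1 - t) / 2 * `|u - v| ^+ 2)%:E)%E.

(* To be used with A open. *)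
Definition C1_on (R : realType) (V : normedModType R) (A : set V) (F : V -> R) : Prop :=
  forall x, A x -> differentiable F x /\
    dual_norm (fun v => 'd F y v - 'd F x v) @[y --> x] --> (0 : R).

(* The differential, a map into the finite-dimensional dual space, is
   continuously differentiable iff all its evaluations at vectors are. *)
Definition C2_on (R : realType) (V : normedModType R) (A : set V) (F : V -> R) : Prop :=
  C1_on A F /\ forall v : V, C1_on A (fun x => 'd F x v).

(* The gradient of an R \cup {+oo}-valued function at an interior point of its
   domain, as the functional v |-> <grad F(u), v>. *)
Definition egrad (R : realType) (V : normedModType R) (F : V -> \bar R) (u : V) : V -> R :=
  'd (fun x => fine (F x)) u.

Definition ess_smooth (R : realType) (V : normedModType R) (F : V -> \bar R) : Prop :=
  C1_on (edom F)° (fun x => fine (F x)) /\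
  forall (u : nat -> V) (l : V), (forall k, (edom F)° (u k)) ->
    (closure (edom F) `\` (edom F)°) l -> u @ \oo --> l ->
    dual_norm (egrad F (u k)) @[k --> \oo] --> +oo.

Definition dgf (R : realType) (V : normedModType R) (U : set V) (omega : V -> \bar R) : Prop :=
  [/\ proper_valued omega,
      U `<=` edom omega,
      {within U, continuous omega},
      strongly_convex_on U omega &
      ess_smooth omega].

Definition bregman (R : realType) (V : normedModType R) (omega : V -> \bar R)
    (u' u : V) : \bar R :=
  (omega u' - omega u - (egrad omega u (u' - u)%R)%:E)%E.

(* [ystar rho x] is the answer of the oracle solving the smoothed dual problem. *)
Record problem (R : realType) (X Y : normedModType R) := Problem {
  r_ : X -> \bar R;
  Phi : X -> Y -> R;
  g_ : Y -> R;
  Yset : set Y;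
  Xopen : set X;
  Yopen : set Y;
  omX : X -> \bar R;
  omY : Y -> \bar R;
  ystar : R -> X -> Y }.

Section Quantities.
Context (R : realType) (X Y : normedModType R) (P : problem X Y).

Definition Xset : set X := edom (r_ P).

Definition f_ (x : X) : R := sup [set Phi P x y - g_ P y | y in Yset P].

Definition q_ (x : X) : \bar R := ((f_ x)%:E + r_ P x)%E.

Definition q_opt : \bar R := ereal_inf (range q_).

Definition smoothed_dual (rho : R) (x : X) (y : Y) : R :=
  Phi P x y - g_ P y - rho * fine (omY P y).

Definition f_rho (rho : R) (x : X) : R :=
  sup [set smoothed_dual rho x y | y in Yset P].

Definition q_rho (rho : R) (x : X) : \bar R := ((f_rho rho x)%:E + r_ P x)%E.

(* Q_rho^lambda(x'; x) is [Qprox rho lambda x x']. *)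
Definition Qprox (rho lambda : R) (x x' : X) : \bar R :=
  (q_rho rho x' + (lambda^-1)%:E * bregman (omX P) x' x)%E.

Definition q_env (rho lambda : R) (x : X) : \bar R :=
  ereal_inf (range (Qprox rho lambda x)).

Definition prox (x : X) (lambda : R) : set X :=
  argmin setT (fun x' => q_ x' + (lambda^-1)%:E * bregman (omX P) x' x)%E.

Definition near_stationary (gamma beta eps : R) (x : X) : Prop :=
  Xset x /\ exists (lambda : R) (p : X),
    [/\ 0 < lambda, lambda < gamma^-1, prox x lambda = [set p] &
        `|lambda^-1 *: (x - p)| <= eps / beta].

Definition gradPhi (x : X) (y : Y) : X -> R := 'd (fun x' => Phi P x' y) x.

Definition Yradius : \bar R := ereal_sup [set `|omY P y|%E | y in Yset P].

Record standing (Lxx Lxy gamma beta RY : R) : Prop := Standing {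
  X_findim : finite_dim X;
  Y_findim : finite_dim Y;
  r_proper : proper_valued (r_ P);
  r_closed : lower_semicontinuous (r_ P);
  r_convex : convex_efun (r_ P);
  X_nonempty : Xset !=set0;
  X_closed : closed Xset;
  X_convex : convex_set Xset;
  Y_nonempty : Yset P !=set0;
  Y_convex : convex_set (Yset P);
  Y_compact : compact (Yset P);
  g_convex : convex_function (Yset P) (g_ P);
  g_cont : {within Yset P, continuous (g_ P)};
  X_sub : Xset `<=` Xopen P;
  Y_sub : Yset P `<=` Yopen P;
  X_open : open (Xopen P);
  Y_open : open (Yopen P);
  Phi_cont : {within Xopen P `*` Yopen P, continuous (fun xy => Phi P xy.1 xy.2)};
  Phi_concave : forall x, Xset x -> convex_function (Yset P) (fun y => - Phi P x y);
  q_bounded : (-oo < q_opt)%E;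
  Phi_diff : forall x y, Xopen P x -> Yset P y ->
    differentiable (fun x' => Phi P x' y) x;
  Lxy_ge0 : 0 <= Lxy;
  Phi_Lxx : forall x x' y, Xset x -> Xset x' -> Yset P y ->
    dual_norm (fun v => gradPhi x y v - gradPhi x' y v) <= Lxx * `|x - x'|;
  Phi_Lxy : forall x y y', Xset x -> Yset P y -> Yset P y' ->
    dual_norm (fun v => gradPhi x y v - gradPhi x y' v) <= Lxy * `|y - y'|;
  gamma_gt0 : 0 < gamma;
  gamma_le : gamma <= Lxx;
  Phi_weakly_convex : forall x x' y, Xset x -> Xset x' -> Yset P y ->
    - (gamma / 2) * `|x' - x| ^+ 2 <= Phi P x' y - Phi P x y - gradPhi x y (x' - x);
  omX_dgf : dgf Xset (omX P);
  omX_C2 : C2_on (edom (omX P))° (fun x => fine (omX P x));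
  omX_int : Xset `<=` (edom (omX P))°;
  beta_ge1 : 1 <= beta;
  omX_smooth : forall x x', Xset x -> Xset x' ->
    dual_norm (fun v => egrad (omX P) x v - egrad (omX P) x' v) <= beta * `|x - x'|;
  omY_dgf : dgf (Yset P) (omY P);
  RY_def : Yradius = RY%:E;
  RY_gt0 : 0 < RY;
  X_simple : forall (xi : {linear X -> R^o}) (alpha : R), 0 < alpha ->
    exists p, argmin Xset
      (fun x => r_ P x + (xi x : R)%:E + (alpha^-1)%:E * omX P x)%E = [set p];
  Y_simple : forall (rho : R) (x : X), 0 < rho -> Xset x ->
    argmax (Yset P) (smoothed_dual rho x) = [set ystar P rho x] }.

End Quantities.

Section ExactAPG.
Context (R : realType) (U : normedModType R).

Definition apg_alpha (theta : R) (t : nat) : R :=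
  if t is t'.+1 then (1 + Num.sqrt theta) ^+ t' * Num.sqrt theta else 1.

Definition apg_A (theta : R) (t : nat) : R := \sum_(i < t.+1) apg_alpha theta i.

Definition apg_tau (theta : R) (t : nat) : R := apg_alpha theta t / apg_A theta t.

(* [gradh u] is the functional v |-> <grad h(u), v>. The values [ubar 0] and
   [w 0] are not used. *)
Record apg_run (Us : set U) (zeta omega : U -> \bar R) (gradh : U -> U -> R)
    (mu Lbar : R) (u0 : U) (s : nat -> U -> R) (z ubar u w : nat -> U) : Prop := APGRun {
  apg_start : Us u0 /\ (edom omega)° u0;
  apg_u0 : u 0%N = u0;
  apg_s0 : s 0%N = gradh (u 0%N);
  apg_z0 : argmin Us (fun a => (s 0%N a)%:E + zeta a + mu%:E * omega a
                                + Lbar%:E * bregman omega a u0)%E (z 0%N);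
  apg_ubar : forall t, argmin Us (fun a => (s t a)%:E
      + (apg_A (mu / Lbar) t)%:E * (zeta a + mu%:E * omega a)
      + Lbar%:E * bregman omega a u0)%E (ubar t.+1);
  apg_u : forall t, u t.+1 = (1 - apg_tau (mu / Lbar) t.+1) *: z t
                             + apg_tau (mu / Lbar) t.+1 *: ubar t.+1;
  apg_s : forall t, s t.+1 =
    fun v => s t v + apg_alpha (mu / Lbar) t.+1 * gradh (u t.+1) v;
  apg_w : forall t, argmin Us (fun a =>
      (apg_alpha (mu / Lbar) t.+1)%:E
        * ((gradh (u t.+1) a)%:E + zeta a + mu%:E * omega a)
      + (apg_A (mu / Lbar) t * mu + Lbar)%:E * bregman omega a (ubar t.+1))%E (w t.+1);
  apg_z : forall t, z t.+1 = (1 - apg_tau (mu / Lbar) t.+1) *: z t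
                             + apg_tau (mu / Lbar) t.+1 *: w t.+1 }.

End ExactAPG.

Section Algorithm.
Context (R : realType) (X Y : normedModType R) (P : problem X Y).

Definition gradh (gamma rho lambda : R) (xk x : X) : X -> R := fun v =>
  gradPhi P x (ystar P rho x) v + gamma * egrad (omX P) x v
  - lambda^-1 * egrad (omX P) xk v.

Definition Lbar (Lxx Lxy gamma beta rho : R) : R :=
  Lxx + gamma * beta + Lxy ^+ 2 / rho.

(* [T] is the first index at which the solver, started at [u0], produces an
   eta-optimal point of the subproblem centred at [xk], and [xk1] is this point. *)
Definition subproblem_solved (Lxx Lxy gamma beta eta lambda rho : R)
    (u0 xk : X) (T : nat) (xk1 : X) : Prop :=
  exists (s : nat -> X -> R) (z ubar u w : nat -> X),
    [/\ apg_run (Xset P) (r_ P) (omX P) (gradh gamma rho lambda xk)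
          (lambda^-1 - gamma) (Lbar Lxx Lxy gamma beta rho) u0 s z ubar u w,
        (Qprox P rho lambda xk (z T) <= q_env P rho lambda xk + eta%:E)%E,
        forall t, (t < T)%N ->
          ~ (Qprox P rho lambda xk (z t) <= q_env P rho lambda xk + eta%:E)%E &
        xk1 = z T].

Definition outer_stop (gamma eta lambda : R) (x : nat -> X) (k : nat) : Prop :=
  `|x k.+1 - x k| <= Num.sqrt (2 * eta / (lambda^-1 - gamma)).

(* A complete execution of the algorithm, with 0-based outer iterations: it stops
   at iteration [K] and outputs [x K]. In iteration [k] the solver is started at
   [start k (x k)] and returns its iterate number [T k]. *)
Record alg_run (Lxx Lxy gamma beta RY eta lambda : R) (start : nat -> X -> X) (x1 : X)
    (x : nat -> X) (T : nat -> nat) (K : nat) : Prop := AlgRun {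
  alg_init : x 0%N = x1;
  alg_step : forall k, (k <= K)%N ->
    subproblem_solved Lxx Lxy gamma beta eta lambda (2 * eta / RY)
      (start k (x k)) (x k) (T k) (x k.+1);
  alg_stop : outer_stop gamma eta lambda x K;
  alg_first : forall k, (k < K)%N -> ~ outer_stop gamma eta lambda x k }.

(* A solver call that returns its iterate number T has evaluated grad h, hence
   grad_x Phi, exactly once at each of u_0, ..., u_T. *)
Definition primal_gradient_count (T : nat -> nat) (K : nat) : nat :=
  (\sum_(k < K.+1) (T k).+1)%N.

Definition start_distances_le (B rho lambda : R) (start : nat -> X -> X)
    (x : nat -> X) (K : nat) : Prop :=
  forall k p, (k <= K)%N -> argmin setT (Qprox P rho lambda (x k)) p ->
    (bregman (omX P) p (start k (x k)) <= B%:E)%E.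

End Algorithm.

(* Main.v *)
Require Import Defs.
From HB Require Import structures.
From mathcomp Require Import all_boot all_order all_algebra.
From mathcomp Require Import all_classical all_reals all_analysis.
From mathcomp Require Import ring lra.

Import Order.TTheory GRing.Theory Num.Theory.
Import numFieldNormedType.Exports.

Local Open Scope classical_set_scope.
Local Open Scope ring_scope.

Set Implicit Arguments.
Unset Strict Implicit.
Unset Printing Implicit Defensive.

(** The proof combines three estimates: the distance of the output from its
proximal point, the number of outer iterations, and the length of one call of
the accelerated solver.

Everything is phrased with [modulus_convex S a F], convexity up to the quadratic
[a / 2 * |x|^2], where [a] may be negative.  Each [Phi _ y] has modulus
[- gamma], and a supremum keeps the modulus of its members, so [f] and [f_rho]
have modulus [- gamma]; adding [lambda^-1] times a Bregman distance of [omX]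
makes the proximal objectives strongly convex with modulus
[mu = lambda^-1 - gamma].  In finite dimension such objectives have a minimiser
([strongly_convex_minimizer]), and values near the minimum control the distance
to it ([modulus_convex_growth]).

Output.  As [|omY| <= RY] on [Yset] and [rho = 2 eta / RY], the functions [f]
and [f_rho] differ by at most [2 eta].  Hence the last iterate [x_{K+1}] is
[5 eta]-optimal for the proximal problem of [q] at [x_K], so it lies within
[sqrt (10 eta / mu)] of the proximal point, while the stopping test bounds
[|x_{K+1} - x_K|] by [sqrt (2 eta / mu)].  The choice of [eta] turns the sum of
the two into at most [lambda eps / beta] ([stopped_near_prox],
[stopping_radius]).

Outer iterations.  When the test fails, the Bregman term alone exceeds
[eta / (1 - gamma lambda) = 10 eta], so [q_rho] drops by at least [9 eta]
([outer_decrease]); the total drop is at most [Delta + 4 eta] ([run_length]).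
This is [O(gamma eps^-2)] iterations.

One solver call.  The smooth part [h] of the subproblem is convex and satisfies
the quadratic upper bound with constant [Lbar] ([h_lower], [h_upper]).  The upper
bound does not require [ystar] to vary smoothly: the growth
[rho / 2 * |y - ystar|^2] of the dual objective absorbs the cross term
[Lxy * |y - ystar| * |v - u|].  An estimate sequence then gives the error
[Lbar D(p, u0) (1 + sqrt (mu / Lbar))^-t] after [t] steps ([apg_rate]), so a
call takes [O(sqrt (Lbar / mu) ln (1 / eps))] steps, where
[sqrt (Lbar / mu) = O(sqrt (Lxx / gamma) + Lxy / eps)] ([call_bound]).  The
product with the number of outer iterations is the stated bound. *)

(** * Convexity up to a quadratic *)

Section ModulusConvexity.
Context (R : realType) (V : normedModType R).
Implicit Types (S : set V) (F G : V -> R) (a b : R).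

Definition modulus_convex S a F := forall u v t, S u -> S v -> 0 <= t <= 1 ->
  F (t *: u + (1 - t) *: v) <=
    t * F u + (1 - t) * F v - a / 2 * (t * (1 - t)) * `|u - v| ^+ 2.

Lemma convex_combE (u v : V) (t : R) :
  t *: u + (1 - t) *: v = v + t *: (u - v).
Proof. by rewrite scalerBr scalerBl scale1r addrCA. Qed.

Lemma convex_setP S (u v : V) (t : R) : convex_set S -> S u -> S v ->
  0 <= t <= 1 -> S (t *: u + (1 - t) *: v).
Proof.
move=> cS Su Sv t01.
have := cS u v (@Itv01 R t _ _).
case/andP: (t01) => t0 t1 /(_ t0 t1).
by rewrite !inE => /(_ Su Sv).
Qed.

Lemma convex_function_modulus S F : convex_function S F -> modulus_convex S 0 F.
Proof.
move=> cF u v t Su Sv /andP[t0 t1].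
have : F (t *: u + (1 - t) *: v) <= t * F u + (1 - t) * F v :=
  cF (Itv01 t0 t1) u v (mem_set Su) (mem_set Sv).
by rewrite !mul0r subr0.
Qed.

Lemma modulus_convexD S a b F G : modulus_convex S a F ->
  modulus_convex S b G -> modulus_convex S (a + b) (fun x => F x + G x).
Proof.
move=> cF cG u v t Su Sv t01.
by have := cF u v t Su Sv t01; have := cG u v t Su Sv t01; lra.
Qed.

Lemma modulus_convexZ S a b F : 0 <= b -> modulus_convex S a F ->
  modulus_convex S (b * a) (fun x => b * F x).
Proof.
move=> b0 cF u v t Su Sv t01.
by have := ler_wpM2l b0 (cF u v t Su Sv t01); lra.
Qed.

(** The elementary form of letting [t] tend to [0] used below. *)
Lemma le_of_le_scaled (x y z d : R) : 0 < d ->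
  (forall t, 0 < t < d -> x - t * y <= z) -> x <= z.
Proof.
move=> d0 H; rewrite leNgt; apply/negP => zx.
pose t := Num.min (d / 2) ((x - z) / (2 * (`|y| + 1))).
have y1 : 0 < 2 * (`|y| + 1) by rewrite mulr_gt0 // ltr_wpDl.
have t0 : 0 < t.
  by rewrite /t lt_min !divr_gt0 // subr_gt0.
have t1 : t <= d / 2 by rewrite /t ge_min lexx.
have t2 : t * (2 * (`|y| + 1)) <= x - z.
  by rewrite -ler_pdivlMr // /t ge_min lexx orbT.
have := H t; rewrite t0 /= => /(_ ltac:(lra)).
have := ler_norm y; have := normr_ge0 y; nra.
Qed.

(** Compare [p] with the points [t *: u + (1 - t) *: p], divide by [t], and let
[t] tend to [0]. *)
Lemma modulus_convex_growth S a F p u : convex_set S -> modulus_convex S a F ->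
  S p -> (forall x, S x -> F p <= F x) -> S u ->
  F p + a / 2 * `|u - p| ^+ 2 <= F u.
Proof.
move=> cS cF Sp minp Su; apply: (@le_of_le_scaled _ (a / 2 * `|u - p| ^+ 2) _ 1) => //.
move=> t /andP[t0 t1]; have t01 : 0 <= t <= 1 by rewrite !ltW.
have := cF u p t Su Sp t01; have := minp _ (convex_setP cS Su Sp t01).
move=> /le_trans/[apply] H.
rewrite -(ler_pM2l t0); move: H; lra.
Qed.

(** The two supporting inequalities at the point [m] of the segment, weighted by
[t] and [1 - t], have linear terms that cancel. *)
Lemma modulus_convex_subgradient S a F (gr : V -> {linear V -> R^o}) :
  convex_set S ->
  (forall u v, S u -> S v -> F u + gr u (v - u) + a / 2 * `|v - u| ^+ 2 <= F v) ->
  modulus_convex S a F.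
Proof.
move=> cS H u v t Su Sv t01; set m := t *: u + _.
have Sm : S m := convex_setP cS Su Sv t01.
have mE : m = v + t *: (u - v).
  exact: convex_combE.
have eu : u - m = (1 - t) *: (u - v).
  by rewrite mE opprD addrA scalerBl scale1r.
have ev : v - m = - t *: (u - v).
  by rewrite mE opprD addrA subrr sub0r scaleNr.
have := H m u Sm Su; have := H m v Sm Sv.
rewrite eu ev !linearZ /= !normrZ normrN.
case/andP: t01 => t0 t1; rewrite (ger0_norm t0) ger0_norm ?subr_ge0 //.
rewrite /GRing.scale /=; set g := gr _ _; set d := `|u - v|.
move=> H1 H2.
have := ler_wpM2l t0 H2; have := ler_wpM2l (_ : 0 <= 1 - t) H1.
rewrite subr_ge0 => /(_ t1); lra.
Qed.

Lemma diff_directional F p (v : V) (e : R) : differentiable F p -> 0 < e ->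
  exists2 d, 0 < d & forall t, 0 < t < d ->
    `|F (p + t *: v) - F p - t * 'd F p v| <= e * t.
Proof.
move=> dF e0.
have : derivable F p v by exact: diff_derivable.
rewrite /derivable => /cvg_ex [l].
move=> cl; have : l = 'd F p v.
  by rewrite -deriveE //; apply/esym/cvg_lim.
move=> le; rewrite {}le in cl.
move/cvgrPdist_le : cl => /(_ e e0).
rewrite near_withinE => /nbhs_ballP[d /= d0 H].
exists d => // t /andP[t0 td].
have := H t; rewrite /ball /= sub0r normrN (gtr0_norm t0) => /(_ td).
rewrite gt_eqF // => /(_ isT).
rewrite /GRing.scale /= (addrC (t *: v)) => H1.
have -> : F (p + t *: v) - F p - t * 'd F p v =
  - (t * ('d F p v - t^-1 * (F (p + t *: v) - F p))).
  by rewrite mulrBr mulrA divff ?gt_eqF // mul1r opprB.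
by rewrite normrN normrM (gtr0_norm t0) mulrC ler_pM2r.
Qed.

Lemma modulus_convex_gradient S a F p u : modulus_convex S a F ->
  S p -> differentiable F p -> S u ->
  F p + 'd F p (u - p) + a / 2 * `|u - p| ^+ 2 <= F u.
Proof.
move=> cF Sp dF Su; set g := 'd F p _; set q := a / 2 * _.
apply/ler_addgt0Pr => e e0.
have [d d0 Hd] := diff_directional (u - p) dF e0.
have d1 : 0 < Num.min 1 d by rewrite lt_min ltr01 d0.
apply: (@le_of_le_scaled _ q _ _ d1) => t /andP[t0].
rewrite lt_min => /andP[t1 td].
have t01 : 0 <= t <= 1 by rewrite !ltW.
have := Hd t; rewrite t0 td => /(_ isT); rewrite ler_norml => /andP[H1 _].
have := cF u p t Su Sp t01.
rewrite convex_combE.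
move=> H2; rewrite -(ler_pM2l t0) /q; move: H1 H2; rewrite -/g; lra.
Qed.

(** The first-order condition for [G + a F], in which only [F] is
differentiable.  Adding [a * (F u - F p)] to both sides gives the three-point
inequality: the objective at [u] exceeds its minimum by at least [a] times the
Bregman distance of [F] from [p] to [u]. *)
Lemma prox_optimality S a F G p u : convex_set S -> modulus_convex S 0 G ->
  0 <= a -> S p -> differentiable F p ->
  (forall x, S x -> G p + a * F p <= G x + a * F x) -> S u ->
  G p - a * 'd F p (u - p) <= G u.
Proof.
move=> cS cG a0 Sp dF minp Su; set g := 'd F p _.
apply/ler_addgt0Pr => e e0.
have e' : 0 < e / (a + 1) by rewrite divr_gt0 // ltr_wpDl.
have ee : a * (e / (a + 1)) <= e.
  by rewrite mulrCA ler_piMr ?ler_pdivrMr ?mul1r ?ltr_wpDl ?lerDl // ltW.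
have [d d0 Hd] := diff_directional (u - p) dF e'.
have d1 : 0 < Num.min 1 d by rewrite lt_min ltr01 d0.
apply: (@le_of_le_scaled _ 0 _ _ d1) => t /andP[t0].
rewrite lt_min => /andP[t1 td].
have t01 : 0 <= t <= 1 by rewrite !ltW.
have := Hd t; rewrite t0 td => /(_ isT); rewrite ler_norml => /andP[_ H1].
have := cG u p t Su Sp t01; have := minp _ (convex_setP cS Su Sp t01).
rewrite convex_combE.
have := ler_wpM2l a0 H1; have := ler_wpM2r (ltW t0) ee; rewrite -/g.
move=> H2 H3 H4 H5; rewrite -(ler_pM2l t0); move: H2 H3 H4 H5; lra.
Qed.

End ModulusConvexity.

(** * Gradient bounds along segments *)

Section Descent.
Context (R : realType) (V : normedModType R).
Implicit Types (S : set V) (F : V -> R).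

Lemma linR_Z (l : {linear V -> R^o}) (a : R) x : l (a *: x) = a * l x.
Proof. by rewrite linearZ. Qed.

(** A difference of continuous linear functionals is bounded on the unit ball, so
the supremum defining [dual_norm] is not a default value. *)
Lemma dual_normP (l1 l2 : {linear V -> R^o}) (K : R) (v : V) :
  continuous l1 -> continuous l2 ->
  dual_norm (fun x => l1 x - l2 x) <= K -> l1 v - l2 v <= K * `|v|.
Proof.
move=> /linear_bounded_continuous/linear_boundedP/pinfty_ex_gt0[r1 _ H1].
move=> /linear_bounded_continuous/linear_boundedP/pinfty_ex_gt0[r2 _ H2] HK.
have [->|v0] := eqVneq v 0; first by rewrite !linear0 addr0 normr0 mulr0.
rewrite -ler_pdivrMr ?normr_gt0 //; apply: le_trans HK.
apply: ub_le_sup.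
  exists (`|r1| + `|r2|) => _ [x /= x1 <-].
  apply: le_trans (ler_norm _) _; apply: le_trans (ler_normB _ _) _.
  apply: lerD; [apply: le_trans (H1 x) _|apply: le_trans (H2 x) _].
    by apply: le_trans (ler_wpM2r (normr_ge0 _) (ler_norm r1)) _; rewrite ler_piMr.
  by apply: le_trans (ler_wpM2r (normr_ge0 _) (ler_norm r2)) _; rewrite ler_piMr.
exists (`|v|^-1 *: v).
  by rewrite /= normrZ normfV normr_id mulVf // normr_eq0.
by rewrite !linR_Z -mulrBr mulrC.
Qed.

Lemma is_derive_line F (u d : V) (t : R) : differentiable F (u + t *: d) ->
  is_derive t 1 (fun s : R => F (u + s *: d)) ('d F (u + t *: d) d).
Proof.
move=> dF; have dv : derivable F (u + t *: d) d by exact: diff_derivable.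
have E : (fun h : R =>
    h^-1 *: (((fun s : R => F (u + s *: d)) \o shift t) (h *: 1) - F (u + t *: d)))
  = (fun h : R => h^-1 *: ((F \o shift (u + t *: d)) (h *: d) - F (u + t *: d))).
  apply/funext => h /=; congr (_ *: (F _ - _)).
  have -> : h *: (1 : R) = h by rewrite /GRing.scale /= mulr1.
  by rewrite scalerDl addrCA addrA.
split; first by rewrite /derivable E.
by rewrite /derive E -deriveE.
Qed.

(** The mean value theorem for [F] along the segment minus its linear part and
[t ^+ 2 * c]: a well chosen [c] makes the right-hand side nonpositive, which
proves [descent] without integration. *)
Lemma mean_value_line F (u v : V) :
  (forall t : R, 0 <= t <= 1 -> differentiable F (u + t *: (v - u))) ->
  forall c : R, exists2 t : R, 0 < t < 1 &
    F v - F u - 'd F u (v - u) - c =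
      'd F (u + t *: (v - u)) (v - u) - 'd F u (v - u) - 2 * t * c.
Proof.
move: (v - u) (subrK u v) => d vE dF c; set g := 'd F u d.
pose psi (t : R) := F (u + t *: d) - (t * g + t ^+ 2 * c).
have dpsi (t : R) : 0 <= t <= 1 -> is_derive t 1 psi ('d F (u + t *: d) d - (g + 2 * t * c)).
  move=> t01; have H := is_derive_line (dF t t01).
  apply: is_derive_eq.
  by rewrite /GRing.scale /= /GRing.scale /=; ring.
have cpsi : {within `[0, 1], continuous psi}.
  apply: derivable_within_continuous => t; rewrite in_itv /= => t01.
  by have [] := dpsi t t01.
have dpsi1 (t : R) : t \in `]0, 1[%R ->
    is_derive t 1 psi (('d F (u + t *: d) d : R) - (g + 2 * t * c)).
  by rewrite in_itv /= => /andP[/ltW t0 /ltW t1]; apply: dpsi; rewrite t0 t1.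
have [t] := MVT ltr01 dpsi1 cpsi.
rewrite in_itv /= => t01 E; exists t => //.
move: E; rewrite /psi scale1r scale0r addr0 (addrC u d) vE expr0n expr1n /=.
lra.
Qed.

Lemma descent S F (L : R) (u v : V) : convex_set S ->
  (forall x, S x -> differentiable F x) ->
  (forall x y, S x -> S y -> dual_norm (fun d => 'd F x d - 'd F y d) <= L * `|x - y|) ->
  S u -> S v -> F v - F u - 'd F u (v - u) <= L / 2 * `|v - u| ^+ 2.
Proof.
move=> cS dF HL Su Sv.
have Sm (t : R) : 0 <= t <= 1 -> S (u + t *: (v - u)).
  by move=> t01; rewrite -convex_combE; exact: convex_setP.
have [t t01] := mean_value_line (fun t ht => dF _ (Sm t ht)) (L / 2 * `|v - u| ^+ 2).
have t01' : 0 <= t <= 1 by case/andP: t01 => *; rewrite !ltW.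
have := dual_normP (v - u) (diff_continuous (dF _ (Sm t t01'))) (diff_continuous (dF _ Su))
  (HL _ _ (Sm t t01') Su).
rewrite addrAC subrr add0r normrZ ger0_norm; last by case/andP: t01'.
move=> H E; rewrite -subr_le0 E; move: H; lra.
Qed.

End Descent.

(** * Compactness in finite dimension *)

Section FiniteDimension.
Context (R : realType) (V : normedModType R).

Definition comb n (b : 'I_n -> V) (c : 'rV[R]_n) : V := \sum_(i < n) c 0 i *: b i.

Lemma comb_is_linear n (b : 'I_n -> V) : linear (comb b).
Proof.
move=> a x y; rewrite /comb scaler_sumr -big_split /=; apply: eq_bigr => i _.
by rewrite !mxE scalerDl scalerA.
Qed.

HB.instance Definition _ n (b : 'I_n -> V) :=
  GRing.isLinear.Build R 'rV[R]_n V *:%R (comb b) (comb_is_linear b).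

Lemma comb_continuous n (b : 'I_n -> V) : continuous (comb b).
Proof.
apply: continuous_big => [|i _ c]; first exact: pseudometric_normed_Zmodule.add_continuous.
apply: (cvgZr_tmp (s := fun x : 'rV[R]_n => x 0 i) (F := nbhs c)); exact: coord_continuous.
Qed.

(** A spanning family of least size is free: a relation with [c 0 j != 0] would
express its [j]-th member through the others. *)
Lemma finite_dim_basis : finite_dim V ->
  exists n (b : 'I_n -> V), (forall v, exists c, comb b c = v) /\
    forall c, comb b c = 0 -> c = 0.
Proof.
move=> fV.
pose spans n := `[< exists b : 'I_n -> V, forall v, exists c, comb b c = v >].
have : exists n, spans n.
  case: fV => n [b Hb]; exists n; apply/asboolP; exists b => v.
  have [c ->] := Hb v; exists (\row_i c i); apply: eq_bigr => i _.
  by rewrite mxE.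
move=> ex; have [n /asboolP[b Hb] minn] := ex_minnP ex.
exists n, b; split => // c c0; apply/eqP; apply: contraPT (leqnn n) => cn0.
have [j cj] : exists j, c 0 j != 0.
  apply/existsP; apply: contraNT cn0; rewrite negb_exists => /forallP H.
  by apply/eqP/rowP => j; rewrite mxE; apply/eqP; have := H j; rewrite negbK.
case: n b Hb minn c c0 cn0 j cj => [|n] b Hb minn c c0 cn0 j cj; first by case: j cj.
suff /minn : spans n by rewrite ltnn.
apply/asboolP; exists (b \o lift j) => v; have [a <-] := Hb v.
pose a' := a - (a 0 j / c 0 j) *: c.
have -> : comb b a = comb b a' by rewrite linearB linearZ /= c0 scaler0 subr0.
exists (\row_i a' 0 (lift j i)).
rewrite /comb (bigD1_ord j) //= {2}/a' !mxE divfK // subrr scale0r add0r.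
by apply: eq_bigr => i _; rewrite !mxE.
Qed.

(** The coordinate map of a basis is a linear bijection; the minimum [m] of its
norm over the unit sphere is positive, so bounded sets have bounded
coordinates. *)
Lemma finite_dim_bounded_closed_compact (A : set V) : finite_dim V ->
  bounded_set A -> closed A -> compact A.
Proof.
move=> /finite_dim_basis[n [b [surj inj]]] bA cA.
have [m m0 Hm] : exists2 m : R, 0 < m & forall c, m * `|c| <= `|comb b c|.
  pose Sph := [set c : 'rV[R]_n | `|c| = 1].
  have [Sph0|Sph0] := pselect (Sph !=set0); last first.
    exists 1 => // c; have [->|c0] := eqVneq c 0; first by rewrite linear0 !normr0 mulr0.
    exfalso; apply: Sph0; exists (`|c|^-1 *: c).
    by rewrite /Sph /= normrZ normfV normr_id mulVf // normr_eq0.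
  have cSph : compact Sph.
    apply: bounded_closed_compact.
      exists 1; split => // x x1 c /= ->; exact: ltW.
    have -> : Sph = (fun c : 'rV[R]_n => `|c|) @^-1` [set 1] by [].
    by apply: preimage_closed => // x _; exact: norm_continuous.
  have cN : {within Sph, continuous (fun c => `|comb b c|)}.
    apply: continuous_subspaceT => c.
    by apply: continuous_comp; [exact: comb_continuous|exact: norm_continuous].
  have [c /[!inE] Sc minc] := compact_EVT_min Sph0 cSph cN.
  exists `|comb b c|.
    rewrite normr_gt0; apply: contra_eqN Sc => /eqP/inj ->.
    by rewrite normr0 eq_sym oner_eq0.
  move=> d; have [->|d0] := eqVneq d 0; first by rewrite linear0 !normr0 mulr0.
  have := minc (`|d|^-1 *: d).
  rewrite inE /Sph /= normrZ normfV normr_id mulVf ?normr_eq0 // => /(_ erefl).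
  by rewrite linearZ /= normrZ normfV normr_id mulrC ler_pdivlMr ?normr_gt0 // mulrC.
have -> : A = comb b @` (comb b @^-1` A).
  by rewrite image_preimage // -subTset => v _; have [c <-] := surj v; exists c.
apply: continuous_compact; first exact/continuous_subspaceT/comb_continuous.
apply: bounded_closed_compact; last first.
  by apply: preimage_closed => // x _; exact: comb_continuous.
have [M [_ HM]] := bA.
exists ((`|M| + 1) / m); split; first exact: num_real.
move=> x Mx c /= Ac.
have M1 : M < `|M| + 1 by rewrite (le_lt_trans (ler_norm _)) // ltrDl.
apply: le_trans (ltW Mx); rewrite ler_pdivlMr // mulrC.
exact: le_trans (Hm c) (HM _ M1 _ Ac).
Qed.

End FiniteDimension.

(** * Minimisers of strongly convex functions *)

Section Minimizers.
Context (R : realType) (V : normedModType R).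
Implicit Types (S : set V) (F : V -> R).

(** Relative to [S], because [f] and the real parts of [r] and [omX] are only
controlled on the domain [Xset]. *)
Definition lsc_on S F := forall p, S p -> forall e : R, 0 < e ->
  \forall x \near p, S x -> F p - e <= F x.

Lemma lsc_onD S F G : lsc_on S F -> lsc_on S G -> lsc_on S (fun x => F x + G x).
Proof.
move=> lF lG p Sp e e0; have e2 : 0 < e / 2 by rewrite divr_gt0.
apply: filterS2 (lF p Sp _ e2) (lG p Sp _ e2) => x Fx Gx Sx.
by have := Fx Sx; have := Gx Sx; lra.
Qed.

Lemma lsc_on_continuous S F : (forall p, S p -> {for p, continuous F}) -> lsc_on S F.
Proof.
move=> cF p Sp e e0; have /cvgrPdist_le/(_ e e0) := cF p Sp.
by apply: filterS => x; rewrite ler_distlC => /andP[? _] _.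
Qed.

(** Strong convexity confines a minimising sequence to a ball around any point
[u0] of [S], and lower semicontinuity passes to a cluster point. *)
Lemma strongly_convex_minimizer S F (a m : R) : finite_dim V ->
  closed S -> convex_set S -> S !=set0 -> 0 < a ->
  modulus_convex S a F -> lsc_on S F -> (forall x, S x -> m <= F x) ->
  exists2 p, S p & forall x, S x -> F p <= F x.
Proof.
move=> fV clS cS [u0 Su0] a0 cF lF lb.
pose I := inf [set F x | x in S].
have hI : has_inf [set F x | x in S].
  by split; [exists (F u0), u0|exists m => _ [x Sx <-]; exact: lb].
have Ilb x : S x -> I <= F x.
  by move=> Sx; apply: ge_inf; [case: hI|exists x].
have /choice[x_ Hx] (k : nat) : exists x, S x /\ F x < I + k.+1%:R^-1.
  have [|_ [x Sx <-] Hx] := @inf_adherent _ [set F x | x in S] k.+1%:R^-1 _ hI.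
    by rewrite invr_gt0.
  by exists x.
(* the midpoint of [u0] and a point of value at most [I + 1] has value at
   least [I], which bounds their distance *)
pose M := 4 * (F u0 + I + 1 - 2 * I) / a + 1.
pose K := S `&` [set x | `|x - u0| ^+ 2 <= M].
have cK : compact K.
  apply: finite_dim_bounded_closed_compact => //.
    exists (M + 1 + `|u0|); split; first exact: num_real.
    move=> r rM x [_ /= Hx']; apply: ltW; apply: le_lt_trans rM.
    rewrite -[x in `|x|](subrK u0); apply: le_trans (ler_normD _ _) _.
    rewrite lerD2r; nra.
  apply: closedI => //.
  have -> : [set x | `|x - u0| ^+ 2 <= M] = (fun x => `|x - u0| ^+ 2) @^-1` [set r | r <= M] by [].
  apply: preimage_closed; last exact: closed_le.
  move=> x _.
  apply: (@continuous_comp _ _ _ (fun y : V => `|y - u0|) (fun r : R => r ^+ 2)).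
    apply: (@continuous_comp _ _ _ (fun y : V => y - u0) (fun y : V => `|y|)).
      by apply: cvgB; [exact: cvg_id|exact: cvg_cst].
    exact: norm_continuous.
  exact: exprn_continuous.
have Kx k : K (x_ k).
  have [Sx Fx] := Hx k; split => //=.
  have t01 : 0 <= (1 / 2 : R) <= 1 by lra.
  have := cF _ _ _ Sx Su0 t01; have := Ilb _ (convex_setP cS Sx Su0 t01).
  move=> /le_trans/[apply] H.
  have k1 : k.+1%:R^-1 <= 1 :> R by rewrite invf_le1 ?ler1n.
  rewrite /M -lerBlDr ler_pdivlMr //.
  have := normr_ge0 (x_ k - u0).
  by move: H Fx k1; move: (k.+1%:R^-1) (F (x_ k)) (F u0) (`|_|) => *; lra.
have [p [Kp clp]] := cK (x_ @ \oo) _ (filterS (fun k _ => Kx k) filterT).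
exists p; first by case: Kp.
move=> x Sx; apply: le_trans (Ilb _ Sx).
apply/ler_addgt0Pr => e e0; have e2 : 0 < e / 2 by rewrite divr_gt0.
have Sp : S p by case: Kp.
have lk : \forall k \near \oo, x_ k \in [set y | S y /\ F y <= I + e / 2].
  near=> k; rewrite inE; have [Sk Fk] := Hx k; split => //=.
  apply: le_trans (ltW Fk) _; rewrite lerD2l; apply: ltW.
  by near: k; exact: near_infty_natSinv_lt (PosNum e2).
have [y [[Sy Fy] Hy]] := clp [set y | S y /\ F y <= I + e / 2] _
  (filterS (fun k => @set_mem _ _ _) lk) (lF p Sp _ e2).
by have := Hy Sy; lra.
Unshelve. all: by end_near. Qed.

End Minimizers.

(** * The accelerated method *)

Section AcceleratedRate.
Context (R : realType).

Lemma apg_A_E (theta : R) (t : nat) : apg_A theta t = (1 + Num.sqrt theta) ^+ t.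
Proof.
elim: t => [|t IH]; first by rewrite /apg_A big_ord1.
by rewrite /apg_A big_ord_recr /= -/(apg_A theta t) IH exprS; ring.
Qed.

Lemma apg_A_gt0 (theta : R) t : 0 < apg_A theta t.
Proof. by rewrite apg_A_E exprn_gt0 // ltr_wpDr // sqrtr_ge0. Qed.

Lemma apg_alphaS (theta : R) t :
  apg_alpha theta t.+1 = apg_A theta t * Num.sqrt theta.
Proof. by rewrite apg_A_E. Qed.

Lemma apg_AS (theta : R) t :
  apg_A theta t.+1 = apg_A theta t + apg_alpha theta t.+1.
Proof. by rewrite /apg_A big_ord_recr. Qed.

Lemma apg_tau_itv (theta : R) t : 0 <= apg_tau theta t.+1 <= 1.
Proof.
have al0 : 0 <= apg_alpha theta t.+1.
  by rewrite apg_alphaS mulr_ge0 ?sqrtr_ge0 // ltW // apg_A_gt0.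
rewrite /apg_tau divr_ge0 ?(ltW (apg_A_gt0 _ _)) //=.
by rewrite ler_pdivrMr ?apg_A_gt0 // mul1r apg_AS lerDr ltW // apg_A_gt0.
Qed.

Context (V : normedModType R) (S : set V) (h zeta om : V -> R)
  (gh : V -> {linear V -> R^o}) (mu L : R).

(** The Bregman distance of a real-valued function, the counterpart of [bregman]
where both arguments lie in the domain. *)
Definition breg (om : V -> R) (a b : V) : R := om a - om b - 'd om b (a - b).

Context (s : nat -> V -> R) (z ubar u w : nat -> V).

Hypothesis cS : convex_set S.
Hypothesis mu0 : 0 < mu.
Hypothesis L0 : 0 < L.
Hypothesis h_lower : forall a b, S a -> S b -> h a + gh a (b - a) <= h b.
Hypothesis h_upper : forall a b, S a -> S b ->
  h b <= h a + gh a (b - a) + L / 2 * `|b - a| ^+ 2.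
Hypothesis zeta_convex : modulus_convex S 0 zeta.
Hypothesis om_convex : modulus_convex S 1 om.
Hypothesis om_diff : forall a, S a -> differentiable om a.

Let th := mu / L.
Let al := apg_alpha th.
Let A := apg_A th.
Let tau := apg_tau th.
Let D := breg om.
Let G a := zeta a + mu * om a.

Hypothesis u0S : S (u 0%N).
Hypothesis s0E : forall a, s 0%N a = gh (u 0%N) a.
Hypothesis sS : forall t a, s t.+1 a = s t a + al t.+1 * gh (u t.+1) a.
Hypothesis z0S : S (z 0%N).
Hypothesis z0_min : forall a, S a ->
  s 0%N (z 0%N) + G (z 0%N) + L * D (z 0%N) (u 0%N) <= s 0%N a + G a + L * D a (u 0%N).
Hypothesis ubarS : forall t, S (ubar t.+1).
Hypothesis ubar_min : forall t a, S a ->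
  s t (ubar t.+1) + A t * G (ubar t.+1) + L * D (ubar t.+1) (u 0%N) <=
  s t a + A t * G a + L * D a (u 0%N).
Hypothesis uS : forall t, u t.+1 = (1 - tau t.+1) *: z t + tau t.+1 *: ubar t.+1.
Hypothesis wS : forall t, S (w t.+1).
Hypothesis w_min : forall t a, S a ->
  al t.+1 * (gh (u t.+1) (w t.+1) + G (w t.+1))
    + (A t * mu + L) * D (w t.+1) (ubar t.+1) <=
  al t.+1 * (gh (u t.+1) a + G a) + (A t * mu + L) * D a (ubar t.+1).
Hypothesis zS : forall t, z t.+1 = (1 - tau t.+1) *: z t + tau t.+1 *: w t.+1.

Lemma lin_comb_sub (l : {linear V -> R^o}) (c : R) x y p :
  l (c *: x + (1 - c) *: y - p) = c * l (x - p) + (1 - c) * l (y - p).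
Proof.
by rewrite !linearB linearD !linearZ /= /GRing.scale /=; ring.
Qed.

Lemma breg_lower a b : S a -> S b -> 1 / 2 * `|a - b| ^+ 2 <= D a b.
Proof.
move=> Sa Sb; have := modulus_convex_gradient om_convex Sb (om_diff Sb) Sa.
rewrite /D /breg; lra.
Qed.

(* The estimate sequence is [E t + A t * G + L * D _ (u 0)], where [E t] is the
   weighted sum of the linear lower models of [h] at [u 0, ..., u t]; [s t] is
   the linear part of [E t], so [ubar t.+1] minimises the estimate sequence. *)
Let lin t a := h (u t) + gh (u t) (a - u t).

Let E t a := \sum_(i < t.+1) al i * lin i a.

Let psi a := h a + G a.

Let G_convex : modulus_convex S 0 G.
Proof.
have H := modulus_convexD zeta_convex (modulus_convexZ (ltW mu0) om_convex).
move=> a b t Sa Sb t01; have := H a b t Sa Sb t01; rewrite /G.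
case/andP: t01 => t0 t1.
have : 0 <= mu * (t * (1 - t) * `|a - b| ^+ 2).
  by rewrite mulr_ge0 ?(ltW mu0) // mulr_ge0 ?sqr_ge0 // mulr_ge0 // subr_ge0.
lra.
Qed.

Let al_gt0 t : 0 < al t.+1.
Proof.
by rewrite /al apg_alphaS mulr_gt0 ?apg_A_gt0 // sqrtr_gt0 divr_gt0.
Qed.

Let tau01 t : 0 <= tau t.+1 <= 1 := apg_tau_itv th t.

Let zSS t : S (z t).
Proof.
elim: t => // t IH; rewrite zS addrC; exact: convex_setP.
Qed.

Let uSS t : S (u t).
Proof. by case: t => // t; rewrite uS addrC; apply: convex_setP. Qed.

Let E_affine t a b : E t a - E t b = s t a - s t b.
Proof.
elim: t => [|t IH].
  rewrite /E !big_ord1 !s0E /lin /al /= !mul1r.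
  by rewrite !linearB; lra.
rewrite /E !(big_ord_recr t.+1) /= -!/(E _ _) !sS /lin.
move: IH; rewrite !linearB /=; lra.
Qed.

Let E_le t a : S a -> E t a <= A t * h a.
Proof.
move=> Sa; rewrite /E /A /apg_A mulr_suml; apply: ler_sum => i _.
apply: ler_wpM2l; last exact: h_lower.
by case: (nat_of_ord i) => //= n; exact/ltW/al_gt0.
Qed.

(* Three-point inequality for the estimate sequence at its minimiser, whose
   strong convexity relative to [om] has modulus [A t * mu + L]. *)
Let ubar_growth t a : S a ->
  s t (ubar t.+1) + A t * G (ubar t.+1) + L * D (ubar t.+1) (u 0%N)
    + (A t * mu + L) * D a (ubar t.+1) <=
  s t a + A t * G a + L * D a (u 0%N).
Proof.
move=> Sa; set p := ubar t.+1.
have Sp : S p := ubarS t.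
pose l x := E t x - L * 'd om (u 0%N) (x - u 0%N).
have l_affine x y (c : R) : l (c *: x + (1 - c) *: y) = c * l x + (1 - c) * l y.
  rewrite /l lin_comb_sub /E !mulrDr.
  have -> : \sum_(i < t.+1) al i * lin i (c *: x + (1 - c) *: y) =
    c * \sum_(i < t.+1) al i * lin i x + (1 - c) * \sum_(i < t.+1) al i * lin i y.
    rewrite !mulr_sumr -big_split /=; apply: eq_bigr => i _.
    by rewrite /lin lin_comb_sub; ring.
  by ring.
pose H x := l x + A t * zeta x.
have cH : modulus_convex S 0 H.
  move=> x y c Sx Sy c01; rewrite /H l_affine.
  by have := ler_wpM2l (ltW (apg_A_gt0 th t)) (zeta_convex Sx Sy c01); rewrite -/A; lra.
have a0 : 0 <= A t * mu + L.
  by rewrite addr_ge0 // ?mulr_ge0 // ltW // apg_A_gt0.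
have minp x : S x -> H p + (A t * mu + L) * om p <= H x + (A t * mu + L) * om x.
  move=> Sx; have := ubar_min t Sx; have := E_affine t x p.
  by rewrite -/p /H /l /G /D /breg; lra.
have := prox_optimality cS cH a0 Sp (om_diff Sp) minp Sa.
have := E_affine t a p.
by rewrite /H /l /G /D /breg; lra.
Qed.

(** The inequality [A t * psi (z t) <= min of the estimate sequence], by
induction on [t].  In the step, the estimate at [a] is bounded below by the
estimate at its minimiser [p] plus [(A t * mu + L) * D a p] plus the new model,
an expression that [v = w t.+1] minimises.  Since [z t.+1 - u t.+1] is
[tau t.+1] times [v - p], the remaining [(A t * mu + L) * D v p] covers the
quadratic error of the upper bound of [h] at [z t.+1]. *)
Lemma estimate_sequence t a : S a ->
  A t * psi (z t) <= E t a + A t * G a + L * D a (u 0%N).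
Proof.
elim: t a => [|t IH] a Sa.
  have := z0_min Sa; have := E_affine 0 a (z 0%N).
  have := h_upper u0S z0S; have := breg_lower z0S u0S.
  rewrite -(ler_pM2l L0) => H1 H2.
  have -> : E 0 a = h (u 0%N) + gh (u 0%N) (a - u 0%N).
    by rewrite /E big_ord1 /al /= mul1r.
  rewrite /E !big_ord1 /lin /al /= /A /apg_A big_ord1 /= /psi; lra.
set b := u t.+1; set p := ubar t.+1; set v := w t.+1; set z' := z t.+1.
have H1 := ubar_growth t Sa.
have H2 := IH p (ubarS t).
have H3 := w_min t Sa.
have H4 := breg_lower (wS t) (ubarS t).
have H5 := h_upper (uSS t.+1) (zSS t.+1).
have H6 := h_lower (uSS t.+1) (zSS t).
have H7 := G_convex (wS t) (zSS t) (tau01 t).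
have Ez : tau t.+1 *: w t.+1 + (1 - tau t.+1) *: z t = z t.+1 by rewrite zS addrC.
rewrite Ez in H7.
have H8 := E_affine t a p.
have EE : E t.+1 a = E t a + al t.+1 * lin t.+1 a by rewrite /E big_ord_recr.
rewrite -/b -/p -/v -/z' in H1 H2 H3 H4 H5 H6 H7 H8 *.
have zu : z' - b = tau t.+1 *: (v - p).
  by rewrite /z' /b zS uS opprD addrACA subrr add0r -scalerBr.
have Agt : 0 < A t := apg_A_gt0 th t; have AgtS : 0 < A t.+1 := apg_A_gt0 th t.+1.
have tauA : tau t.+1 * A t.+1 = al t.+1.
  by rewrite /tau /apg_tau divfK // gt_eqF.
have AE : A t.+1 = A t + al t.+1 := apg_AS _ _.
have AE' : A t.+1 * (1 - tau t.+1) = A t by rewrite mulrBr mulr1 mulrC tauA AE addrK.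
(* this is where the choice of [alpha] enters: [L * al ^+ 2 = A ^+ 2 * mu] *)
have Kc : A t.+1 * (L * tau t.+1 ^+ 2) <= A t * mu + L.
  have sq : Num.sqrt th ^+ 2 = th by rewrite sqr_sqrtr // divr_ge0 // ltW.
  rewrite -(ler_pM2r AgtS).
  have -> : A t.+1 * (L * tau t.+1 ^+ 2) * A t.+1 = L * al t.+1 ^+ 2.
    by rewrite -tauA; ring.
  have -> : L * al t.+1 ^+ 2 = A t ^+ 2 * mu.
    rewrite /al apg_alphaS -/A exprMn sq /th; field.
    by rewrite gt_eqF.
  have := al_gt0 t; rewrite AE; move: (al t.+1) => x x0.
  have := mulr_gt0 Agt mu0; have := mulr_gt0 Agt x0; have := mulr_gt0 L0 Agt.
  have := mulr_gt0 L0 x0; have := mulr_gt0 (mulr_gt0 Agt mu0) x0.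
  rewrite -/A; lra.
have H9 : A t.+1 * (L / 2 * `|z' - b| ^+ 2) <= (A t * mu + L) * D v p.
  have a0 : 0 <= A t * mu + L by rewrite addr_ge0 // ?mulr_ge0 // ltW.
  apply: le_trans (ler_wpM2l a0 H4).
  rewrite zu normrZ exprMn -normrX ger0_norm ?sqr_ge0 //.
  have := ler_wpM2r (sqr_ge0 `|v - p|) Kc; lra.
have H10 : A t.+1 * gh b (z' - b) = al t.+1 * gh b (v - b) + A t * gh b (z t - b).
  rewrite /z' -Ez lin_comb_sub -/v -tauA -AE' ; ring.
have H11 : A t.+1 * G z' <= al t.+1 * G v + A t * G (z t).
  have := ler_wpM2l (ltW AgtS) H7; rewrite -tauA -AE' -/A; lra.
have H12 := ler_wpM2l (ltW AgtS) H5.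
have H13 := ler_wpM2l (ltW Agt) H6.
rewrite EE /psi; move: H1 H2 H3 H8 H9 H10 H11 H12 H13.
rewrite AE /lin -/b /psi !linearB /= -/A; lra.
Qed.

(** The lower models lie below [h], so [E t a <= A t * h a]; and [A t] is the
power [(1 + sqrt (mu / L)) ^+ t]. *)
Lemma apg_rate t a : S a ->
  psi (z t) <= psi a + L * D a (u 0%N) / A t.
Proof.
move=> Sa; have := estimate_sequence t Sa; have := E_le t Sa.
have Agt : 0 < A t := apg_A_gt0 th t.
move=> H1 H2.
have -> : psi a + L * D a (u 0%N) / A t = (A t * psi a + L * D a (u 0%N)) / A t.
  by rewrite [RHS]mulrDl; congr (_ + _); rewrite mulrAC mulfV ?mul1r // gt_eqF.
rewrite ler_pdivlMr // mulrC; move: H1 H2; rewrite /psi; lra.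
Qed.

End AcceleratedRate.

(** * Suprema of families *)

Section SupOfFamily.
Context (R : realType) (V : normedModType R) (Y : Type).
Context (S : set V) (B : set Y) (K : V -> Y -> R).
Context (B0 : B !=set0).
Context (ubK : forall x, S x -> has_ubound [set K x y | y in B]).

Let kmax x := sup [set K x y | y in B].

Lemma sup_family_ge x y : S x -> B y -> K x y <= kmax x.
Proof. by move=> Sx By; apply: ub_le_sup; [exact: ubK|exists y]. Qed.

Lemma sup_family_le x m : (forall y, B y -> K x y <= m) -> kmax x <= m.
Proof.
move=> Hm; apply: sup_le_ub => [|_ [y By <-]]; last exact: Hm.
by have [y By] := B0; exists (K x y), y.
Qed.

Lemma sup_modulus_convex a : convex_set S ->
  (forall y, B y -> modulus_convex S a (fun x => K x y)) ->
  modulus_convex S a kmax.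
Proof.
move=> cS cK u v t Su Sv t01; apply: sup_family_le => y By.
apply: le_trans (cK y By u v t Su Sv t01) _.
case/andP: t01 => t0 t1; rewrite lerD2r lerD // ler_wpM2l ?subr_ge0 //;
exact: sup_family_ge.
Qed.

Lemma sup_lsc : (forall y p, B y -> S p -> {for p, continuous (fun x => K x y)}) ->
  lsc_on S kmax.
Proof.
move=> cK p Sp e e0; have e2 : 0 < e / 2 by rewrite divr_gt0.
have hs : has_sup [set K p y | y in B].
  split; last exact: ubK.
  by have [y By] := B0; exists (K p y), y.
have [_ [y By <-] Hy] := sup_adherent e2 hs.
have /cvgrPdist_le/(_ _ e2) := cK y p By Sp.
apply: filterS => x; rewrite ler_distlC => /andP[Hx _] Sx.
have := sup_family_ge Sx By; rewrite -/(kmax p) in Hy; lra.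
Qed.

End SupOfFamily.

(** * The max-structured problem and its smoothing *)

Section ProblemData.
Context (R : realType) (X Y : normedModType R) (P : problem X Y)
  (Lxx Lxy gamma beta RY : R) (H : standing P Lxx Lxy gamma beta RY).

Local Notation S := (Xset P).

(** On [Xset] the functions [r] and [omX] are finite, and the analysis runs on
their real values. *)
Definition r_real (x : X) : R := fine (r_ P x).
Definition omX_real (x : X) : R := fine (omX P x).

Lemma r_fin x : S x -> r_ P x = (r_real x)%:E.
Proof.
move=> Sx; rewrite fineK // fin_numE (r_proper H) /=.
by move: Sx; rewrite /Xset /edom /= ltey.
Qed.

Lemma r_infty x : ~ S x -> r_ P x = +oo%E.
Proof.
by move=> /negP Sx; apply/eqP; rewrite -leye_eq leNgt.
Qed.

Lemma omX_fin x : S x -> omX P x = (omX_real x)%:E.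
Proof.
have [prop sub _ _ _] := omX_dgf H; move=> /sub Sx.
by rewrite fineK // fin_numE prop /=; move: Sx; rewrite /edom /= ltey.
Qed.

Lemma omY_fin y : Yset P y -> omY P y = (fine (omY P y))%:E.
Proof.
have [prop sub _ _ _] := omY_dgf H; move=> /sub Sx.
by rewrite fineK // fin_numE prop /=; move: Sx; rewrite /edom /= ltey.
Qed.

Lemma bregman_fin a b : S a -> S b ->
  bregman (omX P) a b = (breg omX_real a b)%:E.
Proof. by move=> Sa Sb; rewrite /bregman !omX_fin. Qed.

Lemma omX_modulus_convex : modulus_convex S 1 omX_real.
Proof.
have [_ _ _ sc _] := omX_dgf H; move=> u v t Su Sv t01.
have := sc u v t Su Sv t01; have cS := convex_setP (X_convex H) Su Sv t01.
rewrite !omX_fin // -!EFinM -EFinD. rewrite lee_fin; lra.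
Qed.

Lemma r_modulus_convex : modulus_convex S 0 r_real.
Proof.
move=> u v t Su Sv t01; have cS := convex_setP (X_convex H) Su Sv t01.
have := r_convex H u v t01.
rewrite !r_fin // -!EFinM -EFinD lee_fin; lra.
Qed.

Lemma omX_diff x : S x -> differentiable omX_real x.
Proof.
have [_ _ _ _ [C1 _]] := omX_dgf H.
by move=> Sx; have [] := C1 x (omX_int H Sx).
Qed.

Lemma breg_ge a b : S a -> S b -> 1 / 2 * `|a - b| ^+ 2 <= breg omX_real a b.
Proof.
by move=> Sa Sb; apply: (breg_lower omX_modulus_convex _ Sa Sb); exact: omX_diff.
Qed.

Lemma breg_le a b : S a -> S b -> breg omX_real a b <= beta / 2 * `|a - b| ^+ 2.
Proof.
move=> Sa Sb; apply: (descent (X_convex H) _ _ Sb Sa); first exact: omX_diff.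
exact: omX_smooth H.
Qed.

Lemma breg_self a : breg omX_real a a = 0.
Proof. by rewrite /breg !subrr linear0 subrr. Qed.

Lemma lsc_r : lsc_on S r_real.
Proof.
move=> p Sp e e0; have lt : ((r_real p - e)%:E < r_ P p)%E.
  by rewrite r_fin // lte_fin ltrBlDr ltrDl.
have [U nU HU] := r_closed H lt.
apply: filterS nU => x /HU + Sx.
by rewrite r_fin // lte_fin => /ltW.
Qed.

Lemma omY_bound y : Yset P y -> `|fine (omY P y)| <= RY.
Proof.
move=> By; rewrite -lee_fin -(RY_def H).
by apply: ereal_sup_ubound; exists y => //; rewrite omY_fin.
Qed.

Section Smoothed.
Context (rho : R) (rho0 : 0 < rho).

Lemma ystarP x : S x -> Yset P (ystar P rho x) /\
  forall y, Yset P y -> smoothed_dual P rho x y <= smoothed_dual P rho x (ystar P rho x).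
Proof.
move=> Sx; have := Y_simple H rho0 Sx; rewrite predeqE => /(_ (ystar P rho x)) [_].
by move=> /(_ erefl) [].
Qed.

Lemma smoothed_ub x : S x -> has_ubound [set smoothed_dual P rho x y | y in Yset P].
Proof.
by move=> Sx; exists (smoothed_dual P rho x (ystar P rho x)) => _ [y By <-]; apply: (ystarP Sx).2.
Qed.

Lemma f_rhoE x : S x -> f_rho P rho x = smoothed_dual P rho x (ystar P rho x).
Proof.
move=> Sx; apply/le_anti/andP; split.
  by apply: sup_family_le => [|y By]; [exact: Y_nonempty H|apply: (ystarP Sx).2].
by apply: (sup_family_ge smoothed_ub Sx); apply: (ystarP Sx).1.
Qed.

Lemma smoothed_f x y : Yset P y ->
  `|(Phi P x y - g_ P y) - smoothed_dual P rho x y| <= rho * RY.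
Proof.
move=> By; rewrite /smoothed_dual opprB addrC subrK normrM gtr0_norm //.
by rewrite ler_pM2l // omY_bound.
Qed.

(** Boundedness of [f] is inherited from [f_rho], whose maximiser is given. *)
Lemma f_ub x : S x -> has_ubound [set Phi P x y - g_ P y | y in Yset P].
Proof.
move=> Sx; exists (f_rho P rho x + rho * RY) => _ [y By <-].
have := smoothed_f x By; rewrite ler_norml => /andP[_].
have := sup_family_ge smoothed_ub Sx By; rewrite -/(f_rho P rho x); lra.
Qed.

Lemma f_f_rho x : S x -> `|f_ P x - f_rho P rho x| <= rho * RY.
Proof.
move=> Sx; rewrite ler_norml; apply/andP; split.
  rewrite lerBrDl lerBlDr; apply: (sup_family_le (K := smoothed_dual P rho)) => [|y By].
    exact: Y_nonempty H.
  have := smoothed_f x By; rewrite ler_norml => /andP[+ _].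
  have := sup_family_ge f_ub Sx By; rewrite -/(f_ P x); lra.
rewrite lerBlDr; apply: (sup_family_le (K := fun x y => Phi P x y - g_ P y)) => [|y By].
  exact: Y_nonempty H.
have := smoothed_f x By; rewrite ler_norml => /andP[_].
have := sup_family_ge smoothed_ub Sx By; rewrite -/(f_rho P rho x); lra.
Qed.

End Smoothed.

Lemma Phi_modulus_convex y (c : R) : Yset P y ->
  modulus_convex S (- gamma) (fun x => Phi P x y - c).
Proof.
move=> By; apply: (@modulus_convex_subgradient _ _ _ _ _ (fun u => 'd (fun x' => Phi P x' y) u)).
  exact: X_convex H.
move=> u v Su Sv; have := Phi_weakly_convex H Su Sv By; rewrite /gradPhi; lra.
Qed.

Lemma Phi_continuous y (c : R) p : Yset P y -> S p ->
  {for p, continuous (fun x => Phi P x y - c)}.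
Proof.
move=> By Sp; apply: cvgB; last exact: cvg_cst.
exact: differentiable_continuous (Phi_diff H (X_sub H Sp) By).
Qed.

Lemma f_modulus_convex : modulus_convex S (- gamma) (f_ P).
Proof.
apply: (@sup_modulus_convex R X Y S (Yset P) (fun x y => Phi P x y - g_ P y));
  [exact: Y_nonempty H|exact: (f_ub ltr01)|exact: X_convex H|].
by move=> y By; exact: Phi_modulus_convex.
Qed.

Lemma f_lsc : lsc_on S (f_ P).
Proof.
apply: (@sup_lsc R X Y S (Yset P) (fun x y => Phi P x y - g_ P y));
  [exact: Y_nonempty H|exact: (f_ub ltr01)|].
by move=> y p By Sp; exact: Phi_continuous.
Qed.

Lemma f_rho_modulus_convex rho : 0 < rho -> modulus_convex S (- gamma) (f_rho P rho).
Proof.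
move=> rho0; apply: (@sup_modulus_convex R X Y S (Yset P) (smoothed_dual P rho));
  [exact: Y_nonempty H|exact: smoothed_ub|exact: X_convex H|].
move=> y By u v t Su Sv t01.
have := Phi_modulus_convex (g_ P y + rho * fine (omY P y)) By Su Sv t01.
rewrite /smoothed_dual; lra.
Qed.

Lemma f_rho_lsc rho : 0 < rho -> lsc_on S (f_rho P rho).
Proof.
move=> rho0; apply: (@sup_lsc R X Y S (Yset P) (smoothed_dual P rho));
  [exact: Y_nonempty H|exact: smoothed_ub|].
move=> y p By Sp; have -> : smoothed_dual P rho ^~ y =
    fun x => Phi P x y - (g_ P y + rho * fine (omY P y)).
  by apply/funext => x; rewrite /smoothed_dual opprD addrA.
exact: Phi_continuous.
Qed.

(** Strong concavity of the smoothed dual objective at its maximiser. *)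
Lemma smoothed_growth rho x y : 0 < rho -> S x -> Yset P y ->
  smoothed_dual P rho x y + rho / 2 * `|y - ystar P rho x| ^+ 2 <= f_rho P rho x.
Proof.
move=> rho0 Sx By; have [Bs Hs] := ystarP rho0 Sx.
suff mc : modulus_convex (Yset P) rho (fun y => - smoothed_dual P rho x y).
  have minp z : Yset P z ->
      - smoothed_dual P rho x (ystar P rho x) <= - smoothed_dual P rho x z.
    by move=> Bz; rewrite lerN2; exact: Hs.
  have := modulus_convex_growth (Y_convex H) mc Bs minp By.
  rewrite f_rhoE //; lra.
have [_ _ _ sc _] := omY_dgf H.
move=> u v t Bu Bv t01; have Bm := convex_setP (Y_convex H) Bu Bv t01.
have := sc u v t Bu Bv t01; rewrite (omY_fin Bu) (omY_fin Bv) (omY_fin Bm) -!EFinM -EFinD lee_fin.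
move=> /(ler_wpM2l (ltW rho0)).
have := convex_function_modulus (g_convex H) Bu Bv t01.
have := convex_function_modulus (Phi_concave H Sx) Bu Bv t01.
rewrite /smoothed_dual; lra.
Qed.

End ProblemData.

(** * Proximal subproblems *)

Section Subproblem.
Context (R : realType) (X Y : normedModType R) (P : problem X Y)
  (Lxx Lxy gamma beta RY : R) (H : standing P Lxx Lxy gamma beta RY).

Local Notation S := (Xset P).
Local Notation om := (omX_real P).
Local Notation rr := (r_real P).

Lemma f_rho_lower rho u v : 0 < rho -> S u -> S v ->
  f_rho P rho u + gradPhi P u (ystar P rho u) (v - u) - gamma / 2 * `|v - u| ^+ 2
    <= f_rho P rho v.
Proof.
move=> rho0 Su Sv; have [By _] := ystarP H rho0 Su.
have := sup_family_ge (smoothed_ub H rho0) Sv By; rewrite -/(f_rho P rho v).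
have := Phi_weakly_convex H Su Sv By; rewrite (f_rhoE H rho0 Su) /smoothed_dual; lra.
Qed.

(** With [y = ystar u] and [y' = ystar v], bound [f_rho v] by the dual objective
at [y'], transport it from [v] to [u] by [descent], and pay for replacing the
gradient at [y'] by the one at [y] with the gap [rho / 2 * e ^+ 2] that
[smoothed_growth] leaves between [y'] and the maximiser [y]. *)
Lemma f_rho_upper rho u v : 0 < rho -> S u -> S v ->
  f_rho P rho v <= f_rho P rho u + gradPhi P u (ystar P rho u) (v - u)
    + (Lxx + Lxy ^+ 2 / rho) / 2 * `|v - u| ^+ 2.
Proof.
move=> rho0 Su Sv; set y := ystar P rho u; set y' := ystar P rho v.
have [By _] := ystarP H rho0 Su; have [By' _] := ystarP H rho0 Sv.
have H1 := smoothed_growth H rho0 Su By'.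
have dP z x : Yset P z -> S x -> differentiable (fun x' => Phi P x' z) x.
  by move=> Bz Sx; apply: (Phi_diff H) Bz; exact: (X_sub H).
have H2 := descent (X_convex H) (fun x => dP y' x By')
  (fun a b Sa Sb => Phi_Lxx H Sa Sb By') Su Sv.
have H3 := dual_normP (v - u) (diff_continuous (dP y' u By' Su))
  (diff_continuous (dP y u By Su)) (Phi_Lxy H Su By' By).
rewrite -/y -/y' in H1 H3.
rewrite (f_rhoE H rho0 Sv) -/y' /gradPhi.
move: H1 H2 H3; rewrite /smoothed_dual.
set d := `|v - u|; set e := `|y' - y|.
(* the right-hand side exceeds the left by a square over [2 * rho] *)
have : Lxy * e * d <= rho / 2 * e ^+ 2 + Lxy ^+ 2 / rho / 2 * d ^+ 2.
  have -> : rho / 2 * e ^+ 2 + Lxy ^+ 2 / rho / 2 * d ^+ 2 =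
    Lxy * e * d + (rho * e - Lxy * d) ^+ 2 / (2 * rho).
    by field; rewrite gt_eqF.
  by rewrite lerDl divr_ge0 ?sqr_ge0 // mulr_ge0 // ltW.
move: ('d _ u _) ('d _ u _) => *; lra.
Qed.

(** The proximal objective at the centre [x], for [phi] either [f] or [f_rho]. *)
Definition prox_obj (phi : X -> R) (lam : R) (x a : X) :=
  phi a + rr a + lam^-1 * breg om a x.

Lemma prox_obj_fin phi lam x a : S x -> S a ->
  ((phi a)%:E + r_ P a + (lam^-1)%:E * bregman (omX P) a x)%E = (prox_obj phi lam x a)%:E.
Proof. by move=> Sx Sa; rewrite (r_fin H) // (bregman_fin H) // -EFinM -!EFinD. Qed.

Lemma prox_obj_infty phi lam x a : 0 < lam -> S x -> ~ S a ->
  ((phi a)%:E + r_ P a + (lam^-1)%:E * bregman (omX P) a x)%E = +oo%E.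
Proof.
move=> lam0 Sx nSa; rewrite r_infty // addey //; rewrite /bregman (omX_fin H Sx).
have [prop _ _ _ _] := omX_dgf H; have := prop a.
case: (omX P a) => [c|_|//]; first by [].
by rewrite addye // addye // mulry gtr0_sg ?invr_gt0 // mul1e.
Qed.

Lemma prox_obj_argmin phi lam x p : 0 < lam -> S x ->
  argmin setT (fun a => (phi a)%:E + r_ P a + (lam^-1)%:E * bregman (omX P) a x)%E p
  <-> S p /\ forall a, S a -> prox_obj phi lam x p <= prox_obj phi lam x a.
Proof.
move=> lam0 Sx; split=> [[_ minp]|[Sp minp]].
  have Sp : S p.
    apply: contrapT => nSp; have := minp x I.
    by rewrite prox_obj_infty // prox_obj_fin // leye_eq.
  by split => // a Sa; have := minp a I; rewrite !prox_obj_fin // lee_fin.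
split => // a _; rewrite [leLHS]prox_obj_fin //.
have [Sa|nSa] := pselect (S a); last by rewrite prox_obj_infty // leey.
by rewrite prox_obj_fin // lee_fin minp.
Qed.

Lemma prox_obj_modulus_convex phi b lam x : 0 < lam ->
  modulus_convex S b phi -> modulus_convex S (b + lam^-1) (prox_obj phi lam x).
Proof.
move=> lam0 cphi u v t Su Sv t01.
have H1 := cphi u v t Su Sv t01.
have H2 := r_modulus_convex H Su Sv t01.
have il : 0 <= lam^-1 by rewrite invr_ge0 ltW.
have := ler_wpM2l il (omX_modulus_convex H Su Sv t01).
rewrite /prox_obj /breg lin_comb_sub; lra.
Qed.

(** One minimiser lemma serves the exact problem, where [phi = f], and the smoothed
one, where [phi = f_rho]. *)
Lemma prox_obj_minimizer phi lam m x : 0 < lam -> lam < gamma^-1 -> S x ->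
  modulus_convex S (- gamma) phi -> lsc_on S phi ->
  (forall a, S a -> m <= phi a + rr a) ->
  exists2 p, S p & forall a, S a ->
    prox_obj phi lam x p + (lam^-1 - gamma) / 2 * `|a - p| ^+ 2 <= prox_obj phi lam x a.
Proof.
move=> lam0 lamg Sx cphi lphi lb.
have g0 := gamma_gt0 H.
have mu0 : 0 < lam^-1 - gamma by rewrite subr_gt0 -[gamma]invrK ltf_pV2 ?posrE ?invr_gt0.
have cobj := prox_obj_modulus_convex x lam0 cphi.
rewrite addrC in cobj.
have lobj : lsc_on S (prox_obj phi lam x).
  apply: lsc_onD; first exact: lsc_onD lphi (lsc_r H).
  apply: lsc_on_continuous => p Sp.
  have dl : continuous ('d om x) by apply: diff_continuous; exact: omX_diff H _ Sx.
  apply: cvgM; first exact: cvg_cst.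
  apply: cvgB; last first.
    apply: (@continuous_comp _ _ _ (fun a => a - x) ('d om x)); last exact: dl.
    by apply: cvgB; [exact: cvg_id|exact: cvg_cst].
  apply: cvgB; last exact: cvg_cst.
  exact: differentiable_continuous (omX_diff H Sp).
have [|p Sp minp] := strongly_convex_minimizer (m := m) (X_findim H) (X_closed H) (X_convex H)
  (X_nonempty H) mu0 cobj lobj.
  move=> a Sa; rewrite /prox_obj; have := lb a Sa.
  have : 0 <= lam^-1 * breg om a x.
    rewrite mulr_ge0 ?invr_ge0 ?(ltW lam0) //; have := breg_ge H Sa Sx.
    by apply: le_trans; rewrite mulr_ge0 ?sqr_ge0.
  lra.
exists p => // a Sa; exact: (modulus_convex_growth (X_convex H) cobj Sp minp Sa).
Qed.

Lemma q_opt_real : exists2 m : R, q_opt P = m%:E & forall a, S a -> m <= f_ P a + rr a.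
Proof.
have [x0 Sx0] := X_nonempty H.
have lb a : S a -> (q_opt P <= (f_ P a + rr a)%:E)%E.
  by move=> Sa; apply: ereal_inf_lbound; exists a => //; rewrite /q_ (r_fin H).
exists (fine (q_opt P)); last by move=> a Sa; rewrite -lee_fin fineK ?lb //;
  rewrite fin_numElt (q_bounded H) (le_lt_trans (lb _ Sx0)) ?ltry.
by rewrite fineK // fin_numElt (q_bounded H) (le_lt_trans (lb _ Sx0)) ?ltry.
Qed.

Section Centre.
Context (rho lam : R) (xk : X) (rho0 : 0 < rho) (lam0 : 0 < lam)
  (lamg : lam < gamma^-1) (Sk : S xk).

Local Notation obj := (prox_obj (f_rho P rho) lam xk).

Lemma q_env_minimizer : exists2 p,
  [/\ S p, argmin setT (Qprox P rho lam xk) p & q_env P rho lam xk = (obj p)%:E] &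
  forall a, S a -> obj p + (lam^-1 - gamma) / 2 * `|a - p| ^+ 2 <= obj a.
Proof.
have [m _ lb] := q_opt_real.
have [|p Sp minp] := @prox_obj_minimizer (f_rho P rho) lam (m - rho * RY) xk lam0 lamg Sk
  (f_rho_modulus_convex H rho0) (f_rho_lsc H rho0).
  move=> a Sa; have := lb a Sa; have := f_f_rho H rho0 Sa.
  by rewrite ler_norml; lra.
have am : argmin setT (Qprox P rho lam xk) p.
  apply/(prox_obj_argmin _ _ lam0 Sk); split => // a Sa; apply: le_trans (minp a Sa).
  rewrite lerDl mulr_ge0 ?sqr_ge0 // divr_ge0 // subr_ge0.
  by rewrite -[gamma]invrK lef_pV2 ?posrE ?invr_gt0 ?(gamma_gt0 H) // ltW.
exists p => //; split=> //.
have E : Qprox P rho lam xk p = (obj p)%:E by exact: prox_obj_fin.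
apply/le_anti/andP; split.
  by rewrite -E; apply: ereal_inf_lbound; exists p.
by apply: le_ereal_inf_tmp => _ [a _ <-]; rewrite -E; apply: am.2.
Qed.

Lemma eta_optimalE p z eta : q_env P rho lam xk = (obj p)%:E -> S z ->
  ((Qprox P rho lam xk z <= q_env P rho lam xk + eta%:E)%E <-> obj z <= obj p + eta).
Proof.
move=> -> Sz; have -> : Qprox P rho lam xk z = (obj z)%:E by exact: prox_obj_fin.
by rewrite -EFinD lee_fin.
Qed.

End Centre.

End Subproblem.

(** * Solving a subproblem *)

Section Solver.
Context (R : realType) (X Y : normedModType R) (P : problem X Y)
  (Lxx Lxy gamma beta RY : R) (H : standing P Lxx Lxy gamma beta RY).

Local Notation S := (Xset P).
Local Notation om := (omX_real P).
Local Notation rr := (r_real P).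

Lemma argmin_real (U : Type) (A : set U) (F : U -> \bar R) (G : U -> R) p :
  (forall a, A a -> F a = (G a)%:E) ->
  argmin A F p <-> A p /\ forall a, A a -> G p <= G a.
Proof.
move=> FG; split=> -[Ap minp]; split => // a Aa; have := minp a Aa;
by rewrite !FG // lee_fin.
Qed.

(** Every step of the accelerated method minimises a linear functional plus
positive multiples of [r] and [omX]; dividing by the multiple of [r] gives the
problems assumed solvable. *)
Lemma linear_argmin (xi : {linear X -> R^o}) (c d : R) : 0 < c -> 0 < d ->
  exists2 p, S p & forall a, S a ->
    xi p + c * rr p + d * om p <= xi a + c * rr a + d * om a.
Proof.
move=> c0 d0; have a0 : 0 < c / d by rewrite divr_gt0.
have [p] := X_simple H (c^-1 \*: xi) a0.
rewrite predeqE => /(_ p) [_] /(_ erefl).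
move/(argmin_real (G := fun a => rr a + c^-1 * xi a + d / c * om a)) => [].
  move=> a Sa /=; rewrite (r_fin H Sa) (omX_fin H Sa) -EFinM -!EFinD.
  by rewrite invf_div.
move=> Sp minp; exists p => // a Sa.
have := ler_wpM2l (ltW c0) (minp a Sa).
have E b : c * (rr b + c^-1 * xi b + d / c * om b) = xi b + c * rr b + d * om b.
  by field; rewrite gt_eqF.
by rewrite !E.
Qed.

Definition linear_of (f : X -> R^o) (lf : linear f) : {linear X -> R^o} :=
  HB.pack f (GRing.isLinear.Build R X R^o *:%R f lf).

Section Fixed.
Context (rho lam : R) (xk : X) (rho0 : 0 < rho) (lam0 : 0 < lam)
  (lamg : lam < gamma^-1) (Sk : S xk).

Local Notation mu := (lam^-1 - gamma).
Local Notation L := (Lbar Lxx Lxy gamma beta rho).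

Lemma gradh_linear x : linear (gradh P gamma rho lam xk x : X -> R^o).
Proof.
move=> a u v; rewrite /gradh /gradPhi /egrad.
move: ('d _ x) ('d _ x) ('d _ xk) => l1 l2 l3.
by rewrite !linearP /= /GRing.scale /=; ring.
Qed.

Definition gradh_lin x := linear_of (gradh_linear x).

(** The smooth part of the subproblem: [h_real + r + mu * omX] and the proximal
objective differ by a constant. *)
Definition h_real x := f_rho P rho x + gamma * om x - lam^-1 * 'd om xk x.

Lemma prox_modulus_gt0 : 0 < mu.
Proof. by rewrite subr_gt0 -[gamma]invrK ltf_pV2 ?posrE ?invr_gt0 ?(gamma_gt0 H). Qed.

Lemma gamma_le_Lbar : gamma <= L.
Proof.
rewrite /Lbar; have g0 := gamma_gt0 H; have gL := gamma_le H.
have b1 := beta_ge1 H.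
have : 0 <= Lxy ^+ 2 / rho by rewrite divr_ge0 ?sqr_ge0 // ltW.
have : 0 <= gamma * beta by rewrite mulr_ge0 // ?ltW // (lt_le_trans ltr01).
lra.
Qed.

Lemma Lbar_gt0 : 0 < L.
Proof. exact: lt_le_trans (gamma_gt0 H) gamma_le_Lbar. Qed.

Lemma h_lower a b : S a -> S b -> h_real a + gradh_lin a (b - a) <= h_real b.
Proof.
move=> Sa Sb; have := f_rho_lower H rho0 Sa Sb.
have := ler_wpM2l (ltW (gamma_gt0 H)) (breg_ge H Sb Sa).
rewrite /breg /h_real /gradh_lin /= /gradh /egrad (linearB ('d om xk)) /=.
move: (gradPhi _ _ _ _) ('d _ a _) ('d _ xk a) ('d _ xk b) (`|_| ^+ 2) => *; lra.
Qed.

Lemma h_upper a b : S a -> S b ->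
  h_real b <= h_real a + gradh_lin a (b - a) + L / 2 * `|b - a| ^+ 2.
Proof.
move=> Sa Sb; have := f_rho_upper H rho0 Sa Sb.
have := ler_wpM2l (ltW (gamma_gt0 H)) (breg_le H Sb Sa).
rewrite /breg /h_real /gradh_lin /= /gradh /egrad /Lbar (linearB ('d om xk)) /=.
move: (gradPhi _ _ _ _) ('d _ a _) ('d _ xk a) ('d _ xk b) (`|_| ^+ 2) => *; lra.
Qed.

Local Notation obj := (prox_obj P (f_rho P rho) lam xk).
Local Notation alpha := (apg_alpha (mu / L)).
Local Notation A := (apg_A (mu / L)).
Local Notation tau := (apg_tau (mu / L)).

Lemma apg_run_in_domain u0 s z ubar u w :
  apg_run S (r_ P) (omX P) (gradh P gamma rho lam xk) mu L u0 s z ubar u w ->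
  forall t, S (z t).
Proof.
move=> [_ _ _ [Sz0 _] _ _ _ wP zE]; elim=> // t IH.
by rewrite zE addrC; apply: (convex_setP (X_convex H) (wP t).1 IH); exact: apg_tau_itv.
Qed.

Lemma apg_run_rate u0 s z ubar u w :
  apg_run S (r_ P) (omX P) (gradh P gamma rho lam xk) mu L u0 s z ubar u w ->
  forall t a, S a ->
    obj (z t) <= obj a + L * breg om a u0 / (1 + Num.sqrt (mu / L)) ^+ t.
Proof.
move=> [[Su0 _] u0E s0E z0P ubarP uE sE wP zE] t a Sa.
have [Sz0 z0_min] : S (z 0%N) /\ forall b, S b ->
    s 0%N (z 0%N) + (rr (z 0%N) + mu * om (z 0%N)) + L * breg om (z 0%N) u0 <=
    s 0%N b + (rr b + mu * om b) + L * breg om b u0.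
  move: z0P; apply: (proj1 (argmin_real _ _)) => b Sb.
  by rewrite (r_fin H Sb) (omX_fin H Sb) (bregman_fin H Sb Su0) -!EFinM -!EFinD addrA.
have ubarP' n : S (ubar n.+1) /\ forall b, S b ->
    s n (ubar n.+1) + A n * (rr (ubar n.+1) + mu * om (ubar n.+1)) + L * breg om (ubar n.+1) u0
    <= s n b + A n * (rr b + mu * om b) + L * breg om b u0.
  move: (ubarP n); apply: (proj1 (argmin_real _ _)) => b Sb.
  by rewrite (r_fin H Sb) (omX_fin H Sb) (bregman_fin H Sb Su0).
have wP' n : S (w n.+1) /\ forall b, S b ->
    alpha n.+1 * (gradh_lin (u n.+1) (w n.+1) + (rr (w n.+1) + mu * om (w n.+1)))
      + (A n * mu + L) * breg om (w n.+1) (ubar n.+1)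
    <= alpha n.+1 * (gradh_lin (u n.+1) b + (rr b + mu * om b))
      + (A n * mu + L) * breg om b (ubar n.+1).
  move: (wP n); apply: (proj1 (argmin_real _ _)) => b Sb.
  rewrite (r_fin H Sb) (omX_fin H Sb) (bregman_fin H Sb (ubarP' n).1).
  by rewrite [in RHS]addrA.
have s0E' b : s 0%N b = gradh_lin (u 0%N) b by rewrite s0E.
have sE' n b : s n.+1 b = s n b + alpha n.+1 * gradh_lin (u n.+1) b by rewrite sE.
have := apg_rate (X_convex H) prox_modulus_gt0 Lbar_gt0 h_lower h_upper (r_modulus_convex H)
  (omX_modulus_convex H) (omX_diff H) (s := s) (z := z) (ubar := ubar) (u := u) (w := w).
rewrite u0E in s0E' *.
move=> /(_ Su0 s0E' sE' Sz0 z0_min (fun n => (ubarP' n).1) (fun n => (ubarP' n).2) uE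
  (fun n => (wP' n).1) (fun n => (wP' n).2) zE t a Sa).
rewrite apg_A_E /prox_obj /h_real /breg !linearB /=.
move: ('d _ xk a) ('d _ xk (z t)) ('d _ xk xk) (_ / _) => *; lra.
Qed.


Lemma comb2_linear (a b : R) (l1 l2 : {linear X -> R^o}) :
  linear (fun v => a * l1 v + b * l2 v : R^o).
Proof. by move=> c x y; rewrite !linearP /= /GRing.scale /=; ring. Qed.

Definition comb2 a b l1 l2 : {linear X -> R^o} := linear_of (comb2_linear a b l1 l2).

Lemma linear_argmin_choice : exists amin : {linear X -> R^o} -> R -> R -> X,
  forall xi c d, 0 < c -> 0 < d -> S (amin xi c d) /\ forall a, S a ->
    xi (amin xi c d) + c * rr (amin xi c d) + d * om (amin xi c d)
      <= xi a + c * rr a + d * om a.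
Proof.
pose good (xi : {linear X -> R^o}) (c d : R) p := S p /\ forall a, S a ->
  xi p + c * rr p + d * om p <= xi a + c * rr a + d * om a.
exists (fun xi c d => xget xk (good xi c d)) => xi c d c0 d0.
by apply: (@xgetPex _ xk (good xi c d)); have [p Sp minp] := linear_argmin xi c0 d0; exists p.
Qed.

(** The state carried between steps is the pair of the accumulated functional and
[z]; the other sequences are functions of it. *)
Lemma apg_run_exists u0 : S u0 -> exists s z ubar u w,
  apg_run S (r_ P) (omX P) (gradh P gamma rho lam xk) mu L u0 s z ubar u w.
Proof.
move=> Su0; have [amin aminP] := linear_argmin_choice.
have mu0 := prox_modulus_gt0; have L0 := Lbar_gt0.
have A0 t : 0 < A t := apg_A_gt0 _ _.
have al0 t : 0 < alpha t.+1.
  by rewrite apg_alphaS mulr_gt0 // sqrtr_gt0 divr_gt0.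
pose D b : {linear X -> R^o} := 'd om b.
pose ub t (st : {linear X -> R^o} * X) := amin (comb2 1 (- L) st.1 (D u0)) (A t) (A t * mu + L).
pose uf t st := (1 - tau t.+1) *: st.2 + tau t.+1 *: ub t st.
pose wf t st := amin (comb2 (alpha t.+1) (- (A t * mu + L)) (gradh_lin (uf t st)) (D (ub t st)))
  (alpha t.+1) (alpha t.+1 * mu + (A t * mu + L)).
pose next t st := (comb2 1 (alpha t.+1) st.1 (gradh_lin (uf t st)),
  (1 - tau t.+1) *: st.2 + tau t.+1 *: wf t st).
pose st0 := (gradh_lin u0, amin (comb2 1 (- L) (gradh_lin u0) (D u0)) 1 (mu + L)).
pose st := fix st t := if t is t'.+1 then next t' (st t') else st0.
have AmuL t : 0 < A t * mu + L by rewrite addr_gt0 // mulr_gt0.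
have ubP t := aminP (comb2 1 (- L) (st t).1 (D u0)) _ _ (A0 t) (AmuL t).
have wP t := aminP
  (comb2 (alpha t.+1) (- (A t * mu + L)) (gradh_lin (uf t (st t))) (D (ub t (st t)))) _ _
  (al0 t) (addr_gt0 (mulr_gt0 (al0 t) mu0) (AmuL t)).
exists (fun t => (st t).1), (fun t => (st t).2), (fun t => ub t.-1 (st t.-1)),
  (fun t => if t is t'.+1 then uf t' (st t') else u0), (fun t => wf t.-1 (st t.-1)).
split.
- by split => //; exact: (omX_int H).
- by [].
- by [].
- apply/(argmin_real (G := fun a => gradh_lin u0 a + rr a + mu * om a + L * breg om a u0)).
    by move=> b Sb; rewrite (r_fin H Sb) (omX_fin H Sb) (bregman_fin H Sb Su0).
  have [Sz minz] := aminP (comb2 1 (- L) (gradh_lin u0) (D u0)) _ _ ltr01 (addr_gt0 mu0 L0).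
  split=> // b Sb; move: (minz b Sb) => {minz}.
  rewrite /st /st0 /=; set p := amin _ _ _; rewrite /breg !linearB /= -/(D u0).
  move: (D u0 p) (D u0 b) (D u0 u0) (gradh _ _ _ _ _ _ b) (gradh _ _ _ _ _ _ p) => *; lra.
- move=> t /=; apply/(argmin_real (G := fun a =>
      (st t).1 a + A t * (rr a + mu * om a) + L * breg om a u0)).
    by move=> b Sb; rewrite (r_fin H Sb) (omX_fin H Sb) (bregman_fin H Sb Su0).
  have [Sz minz] := ubP t.
  split=> // b Sb; move: (minz b Sb) => {minz}.
  rewrite -/(ub t (st t)); set p := ub t _; rewrite /comb2 /= /breg !linearB /= -/(D u0).
  move: (D u0 p) (D u0 b) (D u0 u0) ((st t).1 b) ((st t).1 p) => *; lra.
- by [].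
- by move=> t; apply/funext => v /=; rewrite mul1r.
- move=> t /=; have [Sub _] := ubP t; rewrite -/(ub t (st t)) in Sub.
  apply/(argmin_real (G := fun a => alpha t.+1 * (gradh_lin (uf t (st t)) a + rr a + mu * om a)
      + (A t * mu + L) * breg om a (ub t (st t)))).
    by move=> b Sb; rewrite (r_fin H Sb) (omX_fin H Sb) (bregman_fin H Sb Sub).
  have [Sz minz] := wP t.
  split=> // b Sb; move: (minz b Sb) => {minz}.
  rewrite -/(wf t (st t)); set p := wf t _; set q := ub t _.
  rewrite /comb2 /= /breg !linearB /= -/(D q).
  move: (D q p) (D q b) (D q q) (gradh _ _ _ _ _ _ b) (gradh _ _ _ _ _ _ p) => *; lra.
- by [].
Qed.

End Fixed.
End Solver.

(** * The outer loop *)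

Section OuterLoop.
Context (R : realType) (X Y : normedModType R) (P : problem X Y)
  (Lxx Lxy gamma beta RY : R) (H : standing P Lxx Lxy gamma beta RY).

Local Notation S := (Xset P).
Local Notation om := (omX_real P).
Local Notation rr := (r_real P).

Lemma bernoulli (x : R) n : 0 <= x -> 1 + x *+ n <= (1 + x) ^+ n.
Proof.
move=> x0; elim: n => [|n IH]; first by rewrite mulr0n addr0 expr0.
rewrite exprS mulrS; have xn : 0 <= x * (x *+ n) by rewrite mulr_ge0 // mulrn_wge0.
have := ler_wpM2l (_ : 0 <= 1 + x) IH; rewrite addr_ge0 // => /(_ isT); lra.
Qed.

Section Steps.
Context (lam eta : R) (eta0 : 0 < eta) (lam0 : 0 < lam) (lamg : lam < gamma^-1).

Local Notation rho := (2 * eta / RY).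
Local Notation mu := (lam^-1 - gamma).
Local Notation L := (Lbar Lxx Lxy gamma beta rho).
Local Notation obj := (prox_obj P (f_rho P rho) lam).
Local Notation solved := (subproblem_solved P Lxx Lxy gamma beta eta lam rho).
Local Notation stops := (outer_stop gamma eta lam).

Let rho0 : 0 < rho.
Proof. by rewrite divr_gt0 ?(RY_gt0 H) // mulr_gt0. Qed.

Let mu0 : 0 < mu.
Proof. exact: (prox_modulus_gt0 H lam0 lamg). Qed.

Let L0 : 0 < L.
Proof. exact: (Lbar_gt0 H rho0). Qed.

Let gamma_lam_lt1 : gamma * lam < 1.
Proof.
by rewrite -ltr_pdivlMr // div1r -(invrK gamma) ltf_pV2 ?posrE ?invr_gt0 ?(gamma_gt0 H).
Qed.

Lemma f_rho_close x : S x -> `|f_ P x - f_rho P rho x| <= 2 * eta.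
Proof.
move=> Sx; have := f_f_rho H rho0 Sx.
by rewrite divfK // gt_eqF // (RY_gt0 H).
Qed.

Lemma solved_in_domain u0 xk T x1 : solved u0 xk T x1 -> S x1.
Proof. by move=> [s [z [ubar [u [w [run _ _ ->]]]]]]; apply: (apg_run_in_domain H run T). Qed.

Lemma solved_optimal u0 xk T x1 a : S xk -> solved u0 xk T x1 -> S a ->
  obj xk x1 <= obj xk a + eta.
Proof.
move=> Sk sol Sa; have [p [Sp _ env] minp] := q_env_minimizer H rho0 lam0 lamg Sk.
have S1 := solved_in_domain sol; move: sol => [s [z [ubar [u [w [run opt _ xE]]]]]].
rewrite -xE in opt; move/(eta_optimalE H Sk eta env S1): opt => /le_trans; apply.
rewrite lerD2r; apply: le_trans (minp a Sa); rewrite lerDl mulr_ge0 ?sqr_ge0 //.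
by rewrite divr_ge0 // ltW.
Qed.

Lemma solved_length u0 xk T x1 : S xk -> solved u0 xk T.+1 x1 ->
  exists2 p, argmin setT (Qprox P rho lam xk) p &
    eta * (1 + Num.sqrt (mu / L)) ^+ T < L * breg om p u0.
Proof.
move=> Sk sol; have [p [Sp am env] minp] := q_env_minimizer H rho0 lam0 lamg Sk.
move: sol => [s [z [ubar [u [w [run _ notopt _]]]]]].
exists p => //; have Sz := apg_run_in_domain H run T.
have := notopt T (ltnSn T); move/(eta_optimalE H Sk eta env Sz)/negP; rewrite -ltNge.
have := apg_run_rate H rho0 lam0 lamg run T Sp.
move=> H1 H2; have : eta < L * breg om p u0 / (1 + Num.sqrt (mu / L)) ^+ T.
  by move: H1 H2; move: (_ / _ ^+ T) => *; lra.
by rewrite ltr_pdivlMr // exprn_gt0 // ltr_wpDr // sqrtr_ge0.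
Qed.

Lemma solved_exists u0 xk : S u0 -> S xk -> exists T x1, solved u0 xk T x1.
Proof.
move=> Su0 Sk; have [p [Sp am env] minp] := q_env_minimizer H rho0 lam0 lamg Sk.
have [s [z [ubar [u [w run]]]]] := apg_run_exists H xk rho0 lam0 lamg Su0.
pose opt t := `[< (Qprox P rho lam xk (z t) <= q_env P rho lam xk + eta%:E)%E >].
have ex : exists t, opt t.
  pose x := Num.sqrt (mu / L).
  have x0 : 0 < x by rewrite sqrtr_gt0 divr_gt0.
  pose c := L * breg om p u0 / eta / x.
  exists (Num.bound `|c|).+1; set t := (X in X.+1); apply/asboolP.
  apply/(eta_optimalE H Sk eta env (apg_run_in_domain H run t.+1)).
  apply: le_trans (apg_run_rate H rho0 lam0 lamg run t.+1 Sp) _.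
  rewrite lerD2l -/x ler_pdivrMr ?exprn_gt0 ?ltr_wpDr ?(ltW x0) //.
  apply: le_trans (ler_wpM2l (ltW eta0) (bernoulli t.+1 (ltW x0))).
  have ct : c <= t.+1%:R.
    apply: le_trans (ler_norm c) _; apply: ltW; apply: lt_trans (archi_boundP (normr_ge0 _)) _.
    by rewrite ltr_nat.
  have -> : L * breg om p u0 = eta * (c * x) by rewrite /c; field; rewrite !gt_eqF.
  rewrite ler_pM2l // -mulr_natl; have := ler_wpM2r (ltW x0) ct; lra.
have [T /asboolP optT minT] := ex_minnP ex.
exists T, (z T), s, z, ubar, u, w; split => // t tT /asboolP /minT.
by rewrite leqNgt tT.
Qed.

(** A step longer than the threshold costs [eta / (1 - gamma * lam)] in the
Bregman term, while near-optimality against the candidate [x k] itself loses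
only [eta]. *)
Lemma outer_decrease u0 x k T : S (x k) -> solved u0 (x k) T (x k.+1) -> ~ stops x k ->
  f_rho P rho (x k.+1) + rr (x k.+1) + eta / (1 - gamma * lam)
   <= f_rho P rho (x k) + rr (x k) + eta.
Proof.
move=> Sk sol /negP; rewrite -ltNge => nstop.
have S1 := solved_in_domain sol.
have := solved_optimal Sk sol Sk; rewrite /prox_obj breg_self mulr0 addr0.
have D1 := breg_ge H S1 Sk.
suff : eta / (1 - gamma * lam) <= lam^-1 * breg om (x k.+1) (x k) by lra.
have n0 : 0 <= 2 * eta / mu by rewrite divr_ge0 // ?mulr_ge0 // ltW.
have n2 : 2 * eta / mu < `|x k.+1 - x k| ^+ 2.
  by rewrite -[X in X < _](sqr_sqrtr n0) ltr_pXn2r ?nnegrE ?sqrtr_ge0.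
apply: le_trans (ler_wpM2l (_ : 0 <= lam^-1) D1); last by rewrite invr_ge0 ltW.
have -> : eta / (1 - gamma * lam) = lam^-1 * (1 / 2 * (2 * eta / mu)).
  by field; rewrite mulNr !gt_eqF ?subr_gt0 ?gamma_lam_lt1.
by rewrite ler_pM2l ?invr_gt0 // ler_pM2l // ltW.
Qed.

(** Smoothing twice costs [4 * eta], so [x k.+1] is [5 * eta]-optimal for the
unsmoothed proximal problem and within [sqrt 5 <= 3] thresholds of its solution;
the stopping test adds one more threshold. *)
Lemma stopped_near_prox u0 x k T : S (x k) -> solved u0 (x k) T (x k.+1) -> stops x k ->
  exists2 p, prox P (x k) lam = [set p] & `|x k - p| <= 4 * Num.sqrt (2 * eta / mu).
Proof.
move=> Sk sol; rewrite /outer_stop; set c := Num.sqrt _ => stop.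
have S1 := solved_in_domain sol.
have [m _ lb] := q_opt_real H.
have [p Sp minp] := prox_obj_minimizer H lam0 lamg Sk (f_modulus_convex H) (f_lsc H) lb.
have minp' a : S a -> prox_obj P (f_ P) lam (x k) p <= prox_obj P (f_ P) lam (x k) a.
  move=> Sa; apply: le_trans (minp a Sa).
  by rewrite lerDl mulr_ge0 ?sqr_ge0 // divr_ge0 // ltW.
exists p.
  rewrite predeqE => a; split=> [/(prox_obj_argmin H _ _ lam0 Sk) [Sa mina]|->]; last first.
    exact/(prox_obj_argmin H _ _ lam0 Sk).
  have := minp a Sa; have := mina p Sp => H1 H2.
  have : mu / 2 * `|a - p| ^+ 2 <= 0 by move: H1 H2; lra.
  rewrite pmulr_rle0 ?divr_gt0 // => ap.
  have /eqP : `|a - p| ^+ 2 = 0 by apply/le_anti; rewrite ap sqr_ge0.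
  by rewrite sqrf_eq0 normr_eq0 subr_eq0 => /eqP.
have c0 : 0 <= c := sqrtr_ge0 _.
have c2 : mu / 2 * c ^+ 2 = eta.
  rewrite sqr_sqrtr; first by move: mu0; move: (lam^-1 - gamma) => m' m0; field; rewrite gt_eqF.
  by rewrite divr_ge0 ?mulr_ge0 // ltW.
have near1 : `|x k.+1 - p| <= 3 * c.
  have : mu / 2 * `|x k.+1 - p| ^+ 2 <= mu / 2 * (5 * c ^+ 2).
    rewrite [leRHS]mulrCA c2; have := minp _ S1; have := solved_optimal Sk sol Sp.
    have := f_rho_close S1; have := f_rho_close Sp; rewrite !ler_norml /prox_obj.
    move: (_ * `|_| ^+ 2) => *; lra.
  rewrite ler_pM2l ?divr_gt0 // => n2.
  rewrite -(ler_pXn2r (n := 2)) ?nnegrE ?mulr_ge0 //; apply: le_trans n2 _.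
  by rewrite exprMn ler_wpM2r ?sqr_ge0 //; lra.
rewrite -(subrK (x k.+1) (x k)) -addrA; apply: le_trans (ler_normD _ _) _.
rewrite distrC; move: near1 stop; lra.
Qed.

Local Notation c := (eta / (1 - gamma * lam) - eta).

Lemma decrease_gt0 : 0 < c.
Proof.
have g0 := gamma_gt0 H.
have gl0 : 0 < gamma * lam by rewrite mulr_gt0.
have g1 := gamma_lam_lt1.
by rewrite subr_gt0 ltr_pdivlMr ?subr_gt0 // gtr_pMr // gtrBl.
Qed.

Local Notation q x := (f_rho P rho x + r_real P x).

Lemma iterates_decrease start x T n : S (x 0%N) ->
  (forall k, (k < n)%N -> solved (start k (x k)) (x k) (T k) (x k.+1)) ->
  (forall k, (k < n)%N -> ~ stops x k) ->
  S (x n) /\ q (x n) + c *+ n <= q (x 0%N).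
Proof.
move=> S0; elim: n => [|n IH] sol nst; first by rewrite mulr0n addr0.
have [Sn le] := IH (fun k kn => sol k (ltnW kn)) (fun k kn => nst k (ltnW kn)).
split; first exact: solved_in_domain (sol n (ltnSn n)).
have := outer_decrease Sn (sol n (ltnSn n)) (nst n (ltnSn n)).
rewrite (mulrS _ n); move: (c *+ n) le => *; lra.
Qed.

Lemma q_rho_lower m a : S a -> m <= f_ P a + r_real P a -> m - 2 * eta <= q a.
Proof. by move=> Sa; have := f_rho_close Sa; rewrite ler_norml; lra. Qed.

Lemma run_exists start x1 : S x1 -> (forall k x, S x -> S (start k x)) ->
  exists x T K, alg_run P Lxx Lxy gamma beta RY eta lam start x1 x T K.
Proof.
move=> S1 Sstart.
have /choice[step stepP] (kx : nat * X) : exists Ty : nat * X,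
    S kx.2 -> solved (start kx.1 kx.2) kx.2 Ty.1 Ty.2.
  have [Sx|nSx] := pselect (S kx.2); last by exists (0%N, x1).
  by have [T [y]] := solved_exists (Sstart kx.1 _ Sx) Sx; exists (T, y).
pose x := fix x k := if k is k'.+1 then (step (k', x k')).2 else x1.
pose T k := (step (k, x k)).1.
have Sx k : S (x k).
  by elim: k => // k IH; exact: solved_in_domain (stepP (k, x k) IH).
have sol k : solved (start k (x k)) (x k) (T k) (x k.+1) := stepP (k, x k) (Sx k).
have ex : exists k, `[< stops x k >].
  apply: contrapT => nex.
  have nst k : ~ stops x k by move=> st; apply: nex; exists k; exact/asboolP.
  have [m _ lb] := q_opt_real H.
  pose b := (q x1 - (m - 2 * eta)) / c.
  have [_] := iterates_decrease (n := (Num.bound `|b|)) S1 (fun k _ => sol k) (fun k _ => nst k).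
  have := q_rho_lower (Sx (Num.bound `|b|)) (lb _ (Sx (Num.bound `|b|))).
  have := archi_boundP (normr_ge0 b); set N := Num.bound _ => bN H1 H2.
  have : b < N%:R by apply: le_lt_trans (ler_norm b) bN.
  rewrite /b ltr_pdivrMr ?decrease_gt0 // (mulr_natl c N).
  have H3 : q (x N) + c *+ N <= q x1 := H2.
  move: H1 H3; move: (c *+ N) (x N) => *; lra.
have [K /asboolP stK minK] := ex_minnP ex.
exists x, T, K; split => // k kK st.
by have /asboolP/minK := st; rewrite leqNgt kK.
Qed.

Lemma run_in_domain start x1 x T K : S x1 ->
  alg_run P Lxx Lxy gamma beta RY eta lam start x1 x T K ->
  forall k, (k <= K)%N -> S (x k) /\ q (x k) + c *+ k <= q x1.
Proof.
move=> S1 [x0 sol _ nst] k kK; rewrite -x0.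
by apply: (@iterates_decrease start x T k) => [|j jk|j jk];
  [rewrite x0|apply: sol; exact: leq_trans (ltnW jk) kK|apply: nst; exact: leq_trans jk kK].
Qed.

Lemma run_length start x1 x T K Delta : S x1 ->
  alg_run P Lxx Lxy gamma beta RY eta lam start x1 x T K ->
  (q_ P x1 <= q_opt P + Delta%:E)%E -> c *+ K <= Delta + 4 * eta.
Proof.
move=> S1 run; have [m -> lb] := q_opt_real H.
rewrite /q_ (r_fin H S1) -!EFinD lee_fin => le.
have [SK] := run_in_domain S1 run (leqnn K).
have := q_rho_lower SK (lb _ SK); have := f_rho_close S1; rewrite ler_norml.
move: (c *+ K) => *; lra.
Qed.

End Steps.

End OuterLoop.

(** * The constants *)

Section Constants.
Context (R : realType).

Lemma ln1D_lower (x : R) : 0 <= x <= 1 -> x / 2 <= ln (1 + x).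
Proof.
move=> /andP[x0 x1]; have x1p : 0 < 1 + x by rewrite ltr_wpDr.
have := @le_ln1Dx R (- (x / (1 + x))); rewrite ltrN2 ltr_pdivrMr // mul1r ltrDr ltr01 => /(_ isT).
have -> : 1 + - (x / (1 + x)) = (1 + x)^-1 by field; rewrite gt_eqF.
rewrite lnV ?posrE // lerN2; apply: le_trans.
by rewrite ler_wpM2l // lef_pV2 ?posrE //; lra.
Qed.

(** Taking logarithms, with [ln (1 + x) >= x / 2] on the unit interval. *)
Lemma geometric_length (x y : R) n T : 0 < x <= 1 -> 0 < y -> (1 + x) ^+ T <= y ^+ n ->
  T%:R <= 2 * n%:R * x^-1 * ln y.
Proof.
move=> /andP[x0 x1] y0 le; have x1p : 0 < 1 + x by rewrite ltr_wpDr // ltW.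
have := ler_ln; move=> /(_ R _ _ (exprn_gt0 T x1p) (exprn_gt0 n y0)).
rewrite le !lnXn // => H.
have := @ln1D_lower x; rewrite (ltW x0) x1 => /(_ isT) lnx.
have H1 : T%:R * (x / 2) <= n%:R * ln y.
  by apply: le_trans (ler_wpM2l (ler0n _ _) lnx) _; rewrite !mulr_natl.
have -> : 2 * n%:R * x^-1 * ln y = (n%:R * ln y) / (x / 2).
  by field; rewrite gt_eqF.
by rewrite ler_pdivlMr // divr_gt0.
Qed.

End Constants.

Section Complexity.
Context (R : realType) (Delta beta RY B Lxx Lxy gamma eps lam eta : R).

(** [iteration_constant * gamma / eps ^+ 2] bounds the number of outer iterations,
[condition_constant * (sqrt (Lxx / gamma) + Lxy / eps)] bounds
[sqrt (Lbar / mu)], and [log_constant / eps ^+ 4] bounds the argument of the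
logarithm in the length of a call.  The absolute values make all three
meaningful for arbitrary real parameters. *)
Definition iteration_constant := (`|Delta| + 2) * (400 * (beta ^+ 2 + 1)).
Definition condition_constant :=
  3 * Num.sqrt (1 + `|beta|) + 40 * `|beta| * Num.sqrt RY + 1.
Definition log_constant := gamma / 9 * (condition_constant * (Num.sqrt (Lxx / gamma) + Lxy)) ^+ 2
  * (`|B| + 1) * (3200 / 9 * beta ^+ 2 * gamma).

Hypothesis gamma_gt0 : 0 < gamma.
Lemma log_constant_ge0 : 0 <= log_constant.
Proof.
have k0 : 0 <= 3200 / 9 :> R by lra.
rewrite /log_constant; move: (3200 / 9) k0 => k k0.
apply: mulr_ge0; last by rewrite mulr_ge0 ?(ltW gamma_gt0) // mulr_ge0 // sqr_ge0.
by rewrite mulr_ge0 ?addr_ge0 // mulr_ge0 ?sqr_ge0 // divr_ge0 // ltW.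
Qed.

Hypothesis gamma_le : gamma <= Lxx.
Hypothesis Lxy_ge0 : 0 <= Lxy.
Hypothesis beta_ge1 : 1 <= beta.
Hypothesis RY_gt0 : 0 < RY.
Hypothesis eps_gt0 : 0 < eps.
Hypothesis lamE : lam = 9 / 10 * gamma^-1.
Hypothesis etaE : eta = eps ^+ 2 * lam * (1 - gamma * lam) / (32 * beta ^+ 2).

Lemma eta_simpl : eta = 9 / 3200 * eps ^+ 2 / (beta ^+ 2 * gamma).
Proof.
rewrite etaE lamE; field; rewrite !gt_eqF //; exact: lt_le_trans beta_ge1.
Qed.

Lemma mu_simpl : lam^-1 - gamma = gamma / 9.
Proof. by rewrite lamE; field; rewrite gt_eqF. Qed.

Lemma gamma_lam : gamma * lam = 9 / 10.
Proof. by rewrite lamE; field; rewrite gt_eqF. Qed.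

Lemma eta_inv : eta^-1 = 3200 / 9 * beta ^+ 2 * gamma * eps^-1 ^+ 2.
Proof.
rewrite eta_simpl; field; rewrite !gt_eqF //; exact: lt_le_trans beta_ge1.
Qed.

Lemma eta_gt0 : 0 < eta.
Proof.
have b0 : 0 < beta := lt_le_trans ltr01 beta_ge1.
rewrite eta_simpl -mulrA; apply: mulr_gt0; first by lra.
by rewrite divr_gt0 ?mulr_gt0 ?exprn_gt0.
Qed.

Local Notation L := (Lbar Lxx Lxy gamma beta (2 * eta / RY)).
Local Notation mu := (lam^-1 - gamma).
Local Notation W := (Num.sqrt (Lxx / gamma) + Lxy * eps^-1).

Lemma sqrt_Lgamma_ge1 : 1 <= Num.sqrt (Lxx / gamma).
Proof. by rewrite -[X in X <= _]sqrtr1 ler_wsqrtr // ler_pdivlMr // mul1r. Qed.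

Lemma condition_constant_ge1 : 1 <= condition_constant.
Proof. by rewrite /condition_constant lerDr addr_ge0 // !mulr_ge0 // sqrtr_ge0. Qed.

Lemma condition_bound : L / mu <= (condition_constant * W) ^+ 2.
Proof.
have g0 := gamma_gt0; have e0 := eps_gt0; have b0 : 0 < beta := lt_le_trans ltr01 beta_ge1.
have -> : L / mu = 9 * (Lxx / gamma) + 9 * beta + 1600 * beta ^+ 2 * RY * (Lxy * eps^-1) ^+ 2.
  rewrite mu_simpl eta_simpl /Lbar; field; rewrite !gt_eqF //.
rewrite /condition_constant (gtr0_norm b0).
set a := Num.sqrt (Lxx / gamma); set y := Lxy * eps^-1.
have a2 : Lxx / gamma = a ^+ 2.
  by rewrite sqr_sqrtr // divr_ge0 // ltW // (lt_le_trans g0).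
have a1 : 1 <= a := sqrt_Lgamma_ge1.
have y0 : 0 <= y by rewrite mulr_ge0 // invr_ge0 ltW.
set c := Num.sqrt (1 + beta); set d := Num.sqrt RY.
have c0 : 0 <= c := sqrtr_ge0 _; have d0 : 0 <= d := sqrtr_ge0 _.
have c2 : c ^+ 2 = 1 + beta by rewrite sqr_sqrtr // addr_ge0 // ltW.
have d2 : d ^+ 2 = RY by rewrite sqr_sqrtr // ltW.
rewrite a2 -d2; clearbody a y c d; have a0 : 0 <= a := le_trans ler01 a1; have b0' := ltW b0.
apply: (@le_trans _ _ ((3 * c * a + 40 * beta * d * y) ^+ 2)).
  have -> : (3 * c * a + 40 * beta * d * y) ^+ 2 =
    9 * (c ^+ 2) * a ^+ 2 + 1600 * beta ^+ 2 * d ^+ 2 * y ^+ 2 + 240 * (c * a * beta * d * y) by ring.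
  have : 0 <= c * a * beta * d * y by rewrite !mulr_ge0.
  have : 1 <= a ^+ 2 by rewrite expr_ge1.
  rewrite c2; have := ltW b0; nra.
have p1 : 0 <= 3 * c * a + 40 * beta * d * y.
  by rewrite addr_ge0 // !mulr_ge0.
have p2 : 3 * c * a + 40 * beta * d * y <= (3 * c + 40 * beta * d + 1) * (a + y).
  have : 0 <= 3 * c * y + 40 * beta * d * a + a + y.
    by rewrite !addr_ge0 // !mulr_ge0.
  lra.
by rewrite ler_pXn2r // nnegrE // (le_trans p1).
Qed.

Lemma sqrt_condition : (Num.sqrt (mu / L))^-1 <= condition_constant * W.
Proof.
have e0 := eps_gt0.
have g0 := gamma_gt0; have mu0 : 0 < mu by rewrite mu_simpl divr_gt0.
have b0 : 0 < beta := lt_le_trans ltr01 beta_ge1.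
have L0 : 0 < L.
  rewrite ltr_wpDr // ?divr_ge0 ?sqr_ge0 ?mulr_ge0 ?ltW ?eta_gt0 //.
  by rewrite addr_gt0 ?mulr_gt0 // (lt_le_trans g0).
have -> : (Num.sqrt (mu / L))^-1 = Num.sqrt (L / mu).
  by rewrite -(invf_div L mu) sqrtrV ?invrK // divr_ge0 // ltW.
apply: (le_trans (ler_wsqrtr condition_bound)).
rewrite sqrtr_sqr ger0_norm // mulr_ge0 ?(le_trans ler01 condition_constant_ge1) //.
by rewrite addr_ge0 ?sqrtr_ge0 // mulr_ge0 // invr_ge0 ltW.
Qed.

Hypothesis eps_le1 : eps <= 1.
Hypothesis eps_log : eps <= (log_constant + 1)^-1.
Hypothesis eps_gamma : eps <= gamma.
Hypothesis eps_e : eps <= expR (-1).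

(** The argument is [O(eps^-4)]; requiring [eps <= (log_constant + 1)^-1] trades
its constant for one more power of [eps^-1]. *)
Lemma log_argument : L * (`|B| + 1) / eta <= eps^-1 ^+ 5.
Proof.
have g0 := gamma_gt0; have e0 := eps_gt0; have b0 : 0 < beta := lt_le_trans ltr01 beta_ge1.
set s := eps^-1; have s1 : 1 <= s by rewrite invf_ge1.
have mu0 : 0 < mu by rewrite mu_simpl divr_gt0.
have B0 : 0 < `|B| + 1 by rewrite ltr_wpDl.
set w := Num.sqrt (Lxx / gamma) + Lxy.
have C0 : 0 <= condition_constant := le_trans ler01 condition_constant_ge1.
have Ww : W <= w * s.
  rewrite mulrDl lerD2r ler_peMr // sqrtr_ge0 //.
have W0 : 0 <= W by rewrite addr_ge0 ?sqrtr_ge0 // mulr_ge0 // ltW // invr_gt0.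
have LL : L <= gamma / 9 * (condition_constant * (w * s)) ^+ 2.
  rewrite -mu_simpl -ler_pdivrMl // mulrC; apply: le_trans condition_bound _.
  have CW := ler_wpM2l C0 Ww; have CW0 := mulr_ge0 C0 W0.
  by apply: (lerXn2r _ _ _ CW); rewrite nnegrE // (le_trans CW0 CW).
have Ms : log_constant <= s.
  have M0 := log_constant_ge0.
  have : log_constant + 1 <= s by rewrite -[X in X <= _]invrK lef_pV2 ?posrE // invr_gt0 ltr_wpDl.
  lra.
rewrite eta_inv -/s.
have k0 : 0 <= 3200 / 9 * beta ^+ 2 * gamma * s ^+ 2.
  have : 0 <= 3200 / 9 :> R by lra.
  move: (3200 / 9) => k k0; rewrite mulr_ge0 ?sqr_ge0 // mulr_ge0 ?(ltW g0) //.
  by rewrite mulr_ge0 // sqr_ge0.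
apply: le_trans (ler_wpM2r k0 (ler_wpM2r (ltW B0) LL)) _.
have -> : gamma / 9 * (condition_constant * (w * s)) ^+ 2 * (`|B| + 1) *
   (3200 / 9 * beta ^+ 2 * gamma * s ^+ 2) = log_constant * s ^+ 4.
  by rewrite /log_constant -/w; ring.
by rewrite [leRHS]exprS ler_wpM2r // exprn_ge0 // (le_trans ler01).
Qed.

Lemma ln_eps_ge1 : 1 <= ln eps^-1.
Proof.
rewrite lnV ?posrE // lerNr -[X in _ <= X]expRK ler_ln ?posrE // expR_gt0.
Qed.

(** [eps <= 1] and [eps <= gamma] force [eta <= 1], so the additive constants are
absorbed by [eta^-1]. *)
Lemma iterations_simpl K : (eta / (1 - gamma * lam) - eta) *+ K <= Delta + 4 * eta ->
  K.+1%:R <= iteration_constant * gamma * eps^-1 ^+ 2.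
Proof.
have e0 := eta_gt0; have b0 : 0 < beta := lt_le_trans ltr01 beta_ge1.
have -> : eta / (1 - gamma * lam) - eta = 9 * eta by rewrite gamma_lam; field.
have eta1 : eta <= 1.
  rewrite eta_simpl ler_pdivrMr ?mulr_gt0 ?exprn_gt0 // mul1r.
  have : eps ^+ 2 <= gamma by rewrite expr2; apply: le_trans eps_gamma; rewrite ler_piMr // ltW.
  have : gamma <= beta ^+ 2 * gamma by rewrite ler_peMl ?expr_ge1 // ltW.
  have := sqr_ge0 eps; lra.
rewrite -mulr_natr => H.
have HK : K.+1%:R * eta <= `|Delta| + 2.
  rewrite -natr1; have := ler_norm Delta; have := normr_ge0 Delta; move: H eta1 e0; lra.
have -> : K.+1%:R = K.+1%:R * eta * eta^-1 by rewrite mulfK // gt_eqF.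
have ei0 : 0 <= eta^-1 by rewrite invr_ge0 ltW.
apply: le_trans (ler_wpM2r ei0 HK) _; rewrite eta_inv /iteration_constant.
rewrite -!mulrA ler_wpM2l // ?addr_ge0 //.
have : 0 <= gamma * eps^-1 ^+ 2 by rewrite mulr_ge0 ?sqr_ge0 // ltW.
have := sqr_ge0 beta; nra.
Qed.

Lemma call_bound T : eta * (1 + Num.sqrt (mu / L)) ^+ T <= L * (`|B| + 1) -> mu <= L ->
  T.+2%:R <= (2 + 10 * condition_constant) * W * ln eps^-1.
Proof.
have g0 := gamma_gt0; have e0 := eta_gt0; have ep := eps_gt0 => le muL.
have mu0 : 0 < mu by rewrite mu_simpl divr_gt0.
have L0 := lt_le_trans mu0 muL.
have x01 : 0 < Num.sqrt (mu / L) <= 1.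
  rewrite sqrtr_gt0 divr_gt0 //= -[leRHS]sqrtr1 ler_wsqrtr // ler_pdivrMr // mul1r //.
have s0 : 0 < eps^-1 by rewrite invr_gt0.
have := geometric_length (n := 5) (T := T) x01 s0.
have -> : (1 + Num.sqrt (mu / L)) ^+ T <= eps^-1 ^+ 5.
  by apply: le_trans log_argument; rewrite ler_pdivlMr // mulrC.
move=> /(_ isT) H.
have l1 := ln_eps_ge1.
have W1 : 1 <= W.
  by rewrite -[leLHS]addr0 lerD ?sqrt_Lgamma_ge1 // mulr_ge0 // ltW.
have lW : 1 <= W * ln eps^-1 by rewrite mulr_ege1.
have H1 := ler_wpM2r (le_trans ler01 l1) sqrt_condition.
rewrite -!natr1.
move: H H1 lW; move: (Num.sqrt (mu / L))^-1 (ln eps^-1) W => x l v; lra.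
Qed.

End Complexity.

Lemma stopping_radius (R : realType) (beta gamma eps lam eta : R) :
  0 < gamma -> 1 <= beta -> 0 < eps -> lam = 9 / 10 * gamma^-1 ->
  eta = eps ^+ 2 * lam * (1 - gamma * lam) / (32 * beta ^+ 2) ->
  lam^-1 * (4 * Num.sqrt (2 * eta / (lam^-1 - gamma))) = eps / beta.
Proof.
move=> g0 b1 e0 lamE etaE; have b0 : 0 < beta := lt_le_trans ltr01 b1.
have -> : 2 * eta / (lam^-1 - gamma) = (9 / 40 * eps / (gamma * beta)) ^+ 2.
  by rewrite etaE lamE; field; rewrite !gt_eqF.
rewrite sqrtr_sqr ger0_norm; last by rewrite divr_ge0 // ?mulr_ge0 ?ltW //; lra.
by rewrite lamE; field; rewrite !gt_eqF.
Qed.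

Theorem corollary7p1 (R : realType) (Delta beta RY B : R) :
  exists2 C : R, 0 < C &
  forall Lxx Lxy gamma : R,
  exists2 eps0 : R, 0 < eps0 &
  forall (X Y : normedModType R) (P : problem X Y),
    standing P Lxx Lxy gamma beta RY ->
  forall (x1 : X) (start : nat -> X -> X),
    Xset P x1 ->
    (forall k x, Xset P x -> (Xset P `&` (edom (omX P))°) (start k x)) ->
  forall eps lambda eta : R,
    0 < eps ->
    lambda = 9 / 10 * gamma^-1 ->
    eta = eps ^+ 2 * lambda * (1 - gamma * lambda) / (32 * beta ^+ 2) ->
  (exists (x : nat -> X) (T : nat -> nat) (K : nat),
     alg_run P Lxx Lxy gamma beta RY eta lambda start x1 x T K) /\
  (forall (x : nat -> X) (T : nat -> nat) (K : nat),
     alg_run P Lxx Lxy gamma beta RY eta lambda start x1 x T K ->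
     near_stationary P gamma beta eps (x K) /\
     (eps <= eps0 ->
      (q_ P x1 <= q_opt P + Delta%:E)%E ->
      start_distances_le P B (2 * eta / RY) lambda start x K ->
      (primal_gradient_count T K)%:R <=
        C * ((Num.sqrt (gamma * Lxx) + Lxy * gamma * eps^-1) * eps ^- 2 * ln eps^-1))).
Proof.
have C1 := condition_constant_ge1 beta RY.
exists (iteration_constant Delta beta * (2 + 10 * condition_constant beta RY)).
  rewrite /iteration_constant; have := sqr_ge0 beta; have := normr_ge0 Delta => D0 b0.
  have b2 : 0 < 400 * (beta ^+ 2 + 1) by lra.
  have D2 : 0 < `|Delta| + 2 by lra.
  by apply: mulr_gt0 (mulr_gt0 D2 b2) _; lra.
move=> Lxx Lxy gamma.
(* no problem has [gamma <= 0], so any threshold will do there *)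
have [gle0|g0] := leP gamma 0.
  by exists 1 => // X Y P H; have := gamma_gt0 H; rewrite ltNge gle0.
set M := log_constant beta RY B Lxx Lxy gamma.
have M0 : 0 <= M := log_constant_ge0 _ _ _ _ _ g0.
exists (Num.min (Num.min 1 (M + 1)^-1) (Num.min gamma (expR (-1)))).
  by rewrite !lt_min ltr01 g0 expR_gt0 invr_gt0 ltr_wpDl.
move=> X Y P H x1 start S1 Sstart eps lam eta e0 lamE etaE.
have b1 := beta_ge1 H; have RY0 := RY_gt0 H; have gL := gamma_le H; have Lxy0 := Lxy_ge0 H.
have lam0 : 0 < lam by rewrite lamE mulr_gt0 ?invr_gt0 //; lra.
have lamg : lam < gamma^-1.
  have : 0 < gamma^-1 by rewrite invr_gt0.
  by rewrite lamE; lra.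
have eta0 : 0 < eta by apply: eta_gt0 lamE etaE.
split.
  by apply: (run_exists H eta0 lam0 lamg S1) => k x /(Sstart k) [].
move=> x T K run.
have inS k (kK : (k <= K)%N) : Xset P (x k) := (run_in_domain H eta0 lam0 lamg S1 run kK).1.
have sol := alg_step run.
split.
  split; first exact: inS.
  have [p pE le] := stopped_near_prox H eta0 lam0 lamg (inS K (leqnn K))
    (sol K (leqnn K)) (alg_stop run).
  exists lam, p; split => //.
  rewrite normrZ gtr0_norm ?invr_gt0 // -(stopping_radius g0 b1 e0 lamE etaE).
  by rewrite ler_pM2l // invr_gt0.
rewrite !le_min => /andP[/andP[e1 eM] /andP[eg ee]] gap dist.
have itK := iterations_simpl g0 b1 e0 lamE etaE e1 eg (run_length H eta0 lam0 lamg S1 run gap).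
set W := Num.sqrt (Lxx / gamma) + Lxy * eps^-1.
have mu0 := prox_modulus_gt0 H lam0 lamg.
set L := Lbar Lxx Lxy gamma beta (2 * eta / RY).
have rho0 : 0 < 2 * eta / RY by rewrite divr_gt0 // mulr_gt0.
have L0 : 0 < L := Lbar_gt0 H rho0.
have muL : lam^-1 - gamma <= L.
  apply: le_trans (gamma_le_Lbar H rho0); rewrite (mu_simpl g0 lamE); lra.
have ln1 := ln_eps_ge1 e0 ee.
have call k : (k <= K)%N -> (T k).+1%:R <= (2 + 10 * condition_constant beta RY) * W * ln eps^-1.
  move=> kK; case E : (T k) (sol k kK) => [|T'] solk; last first.
    apply: (@call_bound _ _ _ B _ _ _ _ _ eta g0 gL Lxy0 b1 RY0 e0 lamE etaE e1 eM ee T' _ muL).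
    have [p am len] := solved_length H eta0 lam0 lamg (inS k kK) solk.
    apply: (le_trans (ltW len)); rewrite ler_pM2l // -lee_fin.
    have Sp := ((prox_obj_argmin H _ _ lam0 (inS k kK)).1 am).1.
    rewrite -(bregman_fin H Sp (Sstart k _ (inS k kK)).1).
    apply: le_trans (dist k p kK am) _; rewrite lee_fin.
    by rewrite (le_trans (ler_norm B)) // lerDl.
  have W1 : 1 <= W by rewrite -[leLHS]addr0 lerD ?sqrt_Lgamma_ge1 // mulr_ge0 // invr_ge0 ltW.
  have lW : 1 <= W * ln eps^-1 by rewrite mulr_ege1.
  rewrite -mulrA; move: C1 lW; move: (condition_constant _ _) (W * _) => c v c1 v1; nra.
rewrite /primal_gradient_count natr_sum.
apply: (@le_trans _ _ (\sum_(k < K.+1) (2 + 10 * condition_constant beta RY) * W * ln eps^-1)).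
  by apply: ler_sum => k _; apply: call; rewrite -ltnS.
rewrite sumr_const card_ord -(mulr_natl _ K.+1).
have gW : gamma * W = Num.sqrt (gamma * Lxx) + Lxy * gamma * eps^-1.
  rewrite mulrDr; congr (_ + _); last by ring.
  have -> : gamma * Lxx = gamma ^+ 2 * (Lxx / gamma) by field; rewrite gt_eqF.
  by rewrite [RHS]sqrtrM ?sqr_ge0 // sqrtr_sqr gtr0_norm.
rewrite -gW -exprVn.
have c0 : 0 <= (2 + 10 * condition_constant beta RY) * W * ln eps^-1.
  exact: le_trans (ler0n _ _) (call 0%N (leq0n _)).
apply: le_trans (ler_wpM2r c0 itK) _.
by rewrite le_eqVlt; apply/orP; left; apply/eqP; ring.
Qed.
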